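(* Let $k$ be an algebraically closed field of characteristic $p>2$, let $\mathbb{H}=k((y^{\mathbb{Q}}))$ be the Hahn field with its valuation $v$, and let $K$ be a field with $k(y)\subseteq K\subseteq\mathbb{H}$ such that $(K,v)$ is Henselian, $K$ is perfect, and $K$ has no finite limits. Let $$\alpha=\sum_{n=1}^\infty y^{-1/p^n},\qquad \theta=\sum_{n=1}^\infty \alpha^{1/p^n},\qquad \eta=\sum_{n=1}^\infty\alpha^{2/p^n}\in\mathbb{H},$$ so that $\alpha^p-\alpha=y^{-1}$, $\theta^p-\theta=\alpha$, $\eta^p-\eta=\alpha^2$, and let $N=K(\theta,\eta)$. Then $\mathrm{depth}(N/K,v)=2$.
   Context: $\mathbb{H}$ is the field of formal series $s=\sum_{q\in\mathbb{Q}}\lambda_qy^q$, $\lambda_q\in k$, with well-ordered support $\mathrm{supp}(s)=\{q\mid\lambda_q\neq0\}$, and $v(s)=\min\mathrm{supp}(s)$. $K$ has no finite limits if for every $a\in K$ the set $\mathrm{supp}(a)$ has no accumulation point in $\mathbb{R}$ (so $\mathrm{supp}(a)$ is finite or its only limit is $\infty$). $\overline{K}$ denotes the algebraic closure of $K$ in $\mathbb{H}$ and $\Gamma=v\overline{K}$. Depth. For $\zeta\in\overline{K}$ of degree $n$ over $K$ and $1\le m\le n$, let $D_m(\zeta)=\{v(\zeta-b)\mid b\in\overline{K},\ \deg_K b=m\}\subseteq\Gamma\cup\{\infty\}$. Define integers $1=d_0<d_1<\cdots<d_r=n$ by $d_0=1$ and, as long as $d_{\ell-1}<n$, $d_\ell$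 is the least integer $m>d_{\ell-1}$ such that some $\epsilon\in D_m(\zeta)$ satisfies $\epsilon>x$ for all $x\in D_{d_{\ell-1}}(\zeta)$. Then $\mathrm{depth}(\zeta):=r$. (Originally, depth is defined as the common length of the Mac Lane–Vaquié chains of the valuation $f\mapsto v(f(\zeta))$ on $K[x]$; by a known theorem it equals this $r$, which may be taken as the definition.) For a finite simple extension $N/K$ inside $\overline{K}$, $\mathrm{depth}(N/K,v):=\min\{\mathrm{depth}(\zeta)\mid N=K(\zeta)\}$. *)

(* Defs.v *)
From HB Require Import structures.
From mathcomp Require Import all_boot all_order all_algebra.
From mathcomp Require Import all_classical all_reals topology normedtype.
From mathcomp Require Import ring.

Set Implicit Arguments.
Unset Strict Implicit.
Unset Printing Implicit Defensive.
Import Order.TTheory GRing.Theory Num.Theory.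
Import numFieldNormedType.Exports.

Local Open Scope classical_set_scope.
Local Open Scope ring_scope.

Definition well_ordered (A : set rat) :=
  forall B : set rat, B `<=` A -> B !=set0 -> exists2 q, B q & lbound B q.

Section WellOrdered.
Implicit Types A B S T : set rat.

Lemma well_ordered_sub A B : A `<=` B -> well_ordered B -> well_ordered A.
Proof. by move=> AB woB C CA; apply: woB; apply: subset_trans AB. Qed.

Lemma well_ordered0 : well_ordered set0.
Proof. by move=> B B0 [x /B0]. Qed.

Lemma well_ordered1 x : well_ordered [set x].
Proof.
move=> B Bx [y By]; exists y => // z Bz.
by rewrite (Bx _ By) (Bx _ Bz).
Qed.

Lemma well_orderedU A B :
  well_ordered A -> well_ordered B -> well_ordered (A `|` B).
Proof.
move=> woA woB C CAB [x Cx].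
have [CA0|/set0P CA0] := eqVneq (C `&` A) set0.
  have CB : C `<=` B.
    move=> z Cz; case: (CAB _ Cz) => // Az.
    by have : (C `&` A) z by []; rewrite CA0.
  by apply: woB => //; exists x.
have [CB0|/set0P CB0] := eqVneq (C `&` B) set0.
  have CA : C `<=` A.
    move=> z Cz; case: (CAB _ Cz) => // Bz.
    by have : (C `&` B) z by []; rewrite CB0.
  by apply: woA => //; exists x.
have [a [Ca Aa] la] := woA _ (@subIsetr _ C A) CA0.
have [b [Cb Bb] lb] := woB _ (@subIsetr _ C B) CB0.
exists (Num.min a b); first by rewrite /Num.min; case: ifP.
move=> z Cz; rewrite ge_min; case: (CAB _ Cz) => [Az|Bz].
  by rewrite la.
by rewrite lb ?orbT.
Qed.

Lemma well_ordered_local A :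
  (forall x, A x -> well_ordered (A `&` [set y | y <= x])) -> well_ordered A.
Proof.
move=> loc B BA [x Bx].
have [||q [Bq qx] lq] := loc x (BA _ Bx) (B `&` [set y | y <= x]).
- by apply: setSI.
- by exists x; split => /=.
exists q => // z Bz; have [zx|xz] := leP z x; first exact: lq.
exact: le_trans qx (ltW xz).
Qed.

Lemma well_ordered_bigcup n (A : nat -> set rat) :
  (forall i, (i < n)%N -> well_ordered (A i)) ->
  well_ordered (\bigcup_(i in `I_n) A i).
Proof.
elim: n => [|n IH] woA.
  by rewrite II0 bigcup_set0; exact: well_ordered0.
rewrite IIS bigcup_setU bigcup_set1; apply: well_orderedU.
  by apply: IH => i /ltnW/woA.
exact: woA.
Qed.

Lemma well_ordered_scale c A : 0 < c -> well_ordered A ->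
  well_ordered [set q | A (c * q)].
Proof.
move=> c0 woA B BA [x Bx].
have [||_ [y By <-] ly] := woA ( *%R c @` B).
- by move=> _ [z /BA Az <-].
- by exists (c * x), x.
exists y => // z Bz; rewrite -(ler_pM2l c0); apply: ly.
by exists z.
Qed.

Lemma well_ordered_finite A : well_ordered A ->
  (forall B, B `<=` A -> B !=set0 -> exists2 q, B q & ubound B q) ->
  finite_set A.
Proof.
move=> woA cwoA; apply: contrapT => infA.
pose B := [set x | A x /\ ~ finite_set (A `&` [set y | y <= x])].
have [||x [Ax infx] lx] := woA B.
- by move=> x [].
- have [//||M AM uM] := cwoA A.
    apply/set0P/negP => /eqP A0; apply: infA; rewrite A0.
    exact: finite_set0.
  exists M; split => //; rewrite (_ : _ `&` _ = A) //.
  by apply/seteqP; split=> [z []|z Az] //; split => //; exact: uM.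
have infx' : ~ finite_set (A `&` [set y | y < x]).
  move=> fin; apply: infx; apply: (@sub_finite_set _ _
    ((A `&` [set y | y < x]) `|` [set x])).
    move=> y [Ay /=]; rewrite le_eqVlt => /orP[/eqP->|yx]; first by right.
    by left.
  by rewrite finite_setU; split => //; exact: finite_set1.
have [||y [Ay yx] uy] := cwoA (A `&` [set y | y < x]).
- by move=> z [].
- by apply/set0P/negP => /eqP A0; apply: infx'; rewrite A0; exact: finite_set0.
have : B y.
  split => // fin; apply: infx'; apply: sub_finite_set fin => z [Az zx].
  by split => //; apply: uy.
by move/lx; rewrite leNgt; move: (yx : y < x) => ->.
Qed.

Lemma well_ordered_conv S T q : well_ordered S -> well_ordered T ->
  finite_set [set a | S a /\ T (q - a)].
Proof.
move=> woS woT; apply: well_ordered_finite.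
  by apply: well_ordered_sub woS => a [].
move=> B BA [x Bx].
have [||y By ly] := woT [set b | B (q - b)].
- by move=> b /= /BA[_]; rewrite subKr.
- by exists (q - x); rewrite /= subKr.
exists (q - y) => // z Bz.
by rewrite lerBrDl -lerBrDr; apply: ly; rewrite /= subKr.
Qed.

Lemma well_orderedD S T : well_ordered S -> well_ordered T ->
  well_ordered [set q | exists a b, [/\ S a, T b & q = a + b]].
Proof.
move=> woS woT B BST B0.
pose P a b := [/\ S a, T b & B (a + b)].
(* a is admissible if some admissible pair (a, b) is minimal among the pairs
   whose first component is at least a *)
pose C := [set a | exists2 b, P a b &
  forall a' b', P a' b' -> a <= a' -> a + b <= a' + b'].
have step (c : rat) (D := [set b | exists2 a, P a b & a + b < c]) :
    D !=set0 -> exists a b, [/\ P a b, a + b < c &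
     forall a' b', P a' b' -> a <= a' -> a + b <= a' + b'].
  move=> D0; have [|//|b [a Pab abc] lb] := woT D.
    by move=> b [a []].
  exists a, b; split => // a' b' Pab' aa'.
  rewrite leNgt; apply/negP => lt.
  have : b <= b' by apply: lb; exists a' => //; exact: lt_trans abc.
  by rewrite leNgt => /negP; apply; rewrite -(ltrD2l a); apply: le_lt_trans lt;
     rewrite lerD2r.
have C0 : C !=set0.
  have [z Bz] := B0; have [a [b [Sa Tb zE]]] := BST _ Bz.
  have [|a' [b' [Pab _ H]]] := step (z + 1).
    by exists b, a; rewrite /P -?zE ?ltrDl.
  by exists a', b'.
have [|//|m [b Pmb Hm] lm] := woS C; first by move=> a [b []].
exists (m + b); first by case: Pmb.
move=> z Bz; rewrite leNgt; apply/negP => zlt.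
have [|a [b' [Pab lt H]]] := step (m + b).
  by have [a [b' [Sa Tb zE]]] := BST _ Bz; exists b', a; rewrite /P -?zE.
have ma : m <= a by apply: lm; exists b'.
by have := Hm _ _ Pab ma; rewrite leNgt lt.
Qed.

End WellOrdered.

Section HahnDef.
Variable k : fieldType.

Definition supp (f : rat -> k) : set rat := [set q | f q != 0].

Definition wo_supp : {pred rat -> k} := fun f => `[< well_ordered (supp f) >].

Lemma wo_suppP f : reflect (well_ordered (supp f)) (f \in wo_supp).
Proof. exact: asboolP. Qed.

Lemma wo_supp_zmod_closed : zmod_closed wo_supp.
Proof.
split.
  apply/wo_suppP; rewrite (_ : supp _ = set0); first exact: well_ordered0.
  by apply/seteqP; split => // q; rewrite /supp /= eqxx.
move=> f g /wo_suppP wof /wo_suppP wog; apply/wo_suppP.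
apply: well_ordered_sub (well_orderedU wof wog) => q; rewrite /supp /=.
have [fq|] := eqVneq (f q) 0; last by left.
have [gq|] := eqVneq (g q) 0; last by right.
by have -> : (f - g) q = f q - g q by []; rewrite fq gq subrr eqxx.
Qed.

HB.instance Definition _ :=
  GRing.isZmodClosed.Build (rat -> k) wo_supp wo_supp_zmod_closed.

(* The Hahn field k((y^Q)): a series is its family of coefficients. *)
Record hahn := Hahn { hcoef :> rat -> k ; _ : hcoef \in wo_supp }.

HB.instance Definition _ := [isSub for hcoef].
HB.instance Definition _ := [Choice of hahn by <:].
HB.instance Definition _ := [SubChoice_isSubZmodule of hahn by <:].

End HahnDef.

Section HahnRing.
Variable k : fieldType.
Implicit Types s t u : hahn k.

Lemma hahnP s t : (forall q, s q = t q) <-> s = t.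
Proof. by split=> [st|-> //]; apply: val_inj; apply/funext. Qed.

Lemma supp_wo s : well_ordered (supp s).
Proof. by apply/wo_suppP; case: s. Qed.

Lemma hcoef0 q : (0 : hahn k) q = 0. Proof. by []. Qed.
Lemma hcoefD s t q : (s + t) q = s q + t q. Proof. by []. Qed.
Lemma hcoefN s q : (- s) q = - s q. Proof. by []. Qed.
Lemma hcoefB s t q : (s - t) q = s q - t q. Proof. by []. Qed.
Lemma hcoef_sum I (r : seq I) (P : pred I) (F : I -> hahn k) q :
  (\sum_(i <- r | P i) F i) q = \sum_(i <- r | P i) F i q.
Proof. by elim/big_rec2: _ => // i x y _ <-. Qed.

(* c y^q *)
Definition hmono_fun (c : k) (q : rat) : rat -> k :=
  fun r => if r == q then c else 0.

Lemma hmono_subproof c q : hmono_fun c q \in @wo_supp k.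
Proof.
apply/wo_suppP; apply: well_ordered_sub (@well_ordered1 q) => r.
by rewrite /supp /hmono_fun /=; case: (r =P q) => //; rewrite eqxx.
Qed.

Definition hmono c q : hahn k := Hahn (hmono_subproof c q).

Lemma hmono_neq0 c q r : hmono c q r != 0 -> r = q.
Proof. by rewrite /= /hmono_fun; case: (r =P q) => //; rewrite eqxx. Qed.

Definition hmul_fun s t : rat -> k :=
  fun q => \sum_(a \in [set: rat]) s a * t (q - a).

Lemma conv_finite s t q :
  finite_set [set a | s a != 0 /\ t (q - a) != 0].
Proof. exact: well_ordered_conv (@supp_wo s) (@supp_wo t). Qed.

Lemma hmul_funE s t q (X : set rat) :
    (forall a, s a != 0 -> t (q - a) != 0 -> X a) ->
  hmul_fun s t q = \sum_(a \in X) s a * t (q - a).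
Proof.
move=> HX; apply/esym/fsbig_widen => // a [_ nXa] /=.
apply/eqP; rewrite mulf_eq0; apply/norP => -[sa ta].
by apply: nXa; exact: HX.
Qed.

Lemma hmul_neq0 s t q : hmul_fun s t q != 0 ->
  exists a b, [/\ s a != 0, t b != 0 & q = a + b].
Proof.
rewrite /hmul_fun => H.
have [a _] := fsbigN1 (f := fun (x : unit) a => s a * t (q - a)) (x := tt) H.
rewrite mulf_eq0 => /norP[sa ta]; exists a, (q - a); split => //.
by rewrite addrC subrK.
Qed.

Lemma hmul_subproof s t : hmul_fun s t \in @wo_supp k.
Proof.
apply/wo_suppP.
apply: well_ordered_sub (well_orderedD (@supp_wo s) (@supp_wo t)) => q.
exact: hmul_neq0.
Qed.

Definition hmul s t : hahn k := Hahn (hmul_subproof s t).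

Lemma hmulC : commutative hmul.
Proof.
move=> s t; apply/hahnP => q /=; rewrite /hmul_fun.
have bij : bijective (fun a : rat => q - a).
  by exists (fun a => q - a) => a; rewrite subKr.
rewrite (reindex_fsbigT _ _ bij).
by apply: eq_fsbigr => a _; rewrite subKr mulrC.
Qed.

Lemma hmulDl : left_distributive hmul +%R.
Proof.
move=> s t u; apply/hahnP => q; rewrite hcoefD /=.
pose X := [set a | s a != 0 /\ u (q - a) != 0] `|`
  [set a | t a != 0 /\ u (q - a) != 0].
have fX : finite_set X by rewrite finite_setU; split; apply: conv_finite.
rewrite !(@hmul_funE _ _ _ X).
- by rewrite -fsbig_split//; apply: eq_fsbigr => a _; exact: mulrDl.
- by move=> a *; right.
- by move=> a *; left.
- move=> a; rewrite hcoefD; have [->|] := eqVneq (s a) 0.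
    by rewrite add0r => *; right.
  by move=> *; left.
Qed.

Lemma hmul1 : left_id (hmono 1 0) hmul.
Proof.
move=> s; apply/hahnP => q /=.
rewrite (@hmul_funE _ _ _ [set 0]); last first.
  by move=> a /hmono_neq0->.
by rewrite fsbig_set1 /= /hmono_fun eqxx mul1r subr0.
Qed.

Lemma hmulA : associative hmul.
Proof.
move=> s t u; apply/hahnP => q /=.
pose B := [set b | s b != 0 /\ hmul t u (q - b) != 0].
pose B' := [set b | s b != 0 /\ exists c, [/\ t c != 0 & u (q - b - c) != 0]].
have fB' : finite_set B'.
  apply: sub_finite_set (well_ordered_conv q (@supp_wo s)
    (well_orderedD (@supp_wo t) (@supp_wo u))) => b [sb [c [tc uc]]].
  by split => //; exists c, (q - b - c); split => //; ring.
pose A := \bigcup_(b in B') [set a | t (a - b) != 0 /\ u (q - a) != 0].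
have fA : finite_set A.
  apply: bigcup_finite => // b _.
  apply: (@sub_finite_set _ _
    ((fun c => b + c) @` [set c | t c != 0 /\ u (q - b - c) != 0])).
    move=> a [ta ua]; exists (a - b); last by ring.
    by split => //; have -> : q - b - (a - b) = q - a by ring.
  apply: finite_image; exact: conv_finite.
have AB b a : s b != 0 -> t (a - b) != 0 -> u (q - a) != 0 -> A a /\ B' b.
  move=> sb ta ua.
  have Bb : B' b.
    split => //; exists (a - b); split => //.
    by have -> : q - b - (a - b) = q - a by ring.
  by split => //; exists b.
transitivity (\sum_(b \in B') \sum_(a \in A) s b * (t (a - b) * u (q - a))).
  rewrite (@hmul_funE _ _ _ B'); last first.
    move=> b sb /hmul_neq0 [c [d [tc ud qbE]]]; split => //.
    by exists c; split => //; rewrite qbE addrC addKr.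
  apply: eq_fsbigr => b /set_mem[sb _]; rewrite -mulr_fsumr; congr (_ * _).
  rewrite /= /hmul_fun.
  have bij : bijective (fun a : rat => a - b).
    by exists (fun a => a + b) => a; rewrite ?subrK ?addrK.
  rewrite (reindex_fsbigT _ _ bij); apply/esym.
  have E a : q - b - (a - b) = q - a by ring.
  under [RHS]eq_fsbigr do rewrite E.
  apply: fsbig_widen => // a [_ nAa] /=.
  apply/eqP; rewrite mulf_eq0; apply/norP => -[ta ua].
  by apply: nAa; case: (AB b a).
rewrite exchange_fsbig// (@hmul_funE (hmul s t) u q A); last first.
  move=> a /hmul_neq0[b [c [sb tc aE]]] ua.
  by case: (AB b a) => //; rewrite aE addrC addKr.
apply: eq_fsbigr => a _ /=.
have [->|ua] := eqVneq (u (q - a)) 0.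
  by rewrite mulr0 fsbig1// => b _; rewrite !mulr0.
rewrite (@hmul_funE _ _ _ B'); last by move=> b sb tb; case: (AB b a).
by rewrite mulr_fsuml; apply: eq_fsbigr => b _; rewrite mulrA.
Qed.

Lemma hone_neq0 : hmono 1 0 != 0.
Proof.
apply/eqP => /hahnP/(_ 0); rewrite hcoef0 /= /hmono_fun eqxx.
by apply/eqP; exact: oner_neq0.
Qed.

HB.instance Definition _ := GRing.Zmodule_isComNzRing.Build (hahn k)
  hmulA hmulC hmul1 hmulDl hone_neq0.

Lemma hcoefM s t q : (s * t) q = \sum_(a \in [set: rat]) s a * t (q - a).
Proof. by []. Qed.

Lemma hcoef1 q : (1 : hahn k) q = (q == 0)%:R.
Proof. by rewrite [LHS]/= /hmono_fun; case: eqP. Qed.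

Lemma hcoefM_neq0 s t q : (s * t) q != 0 ->
  exists a b, [/\ s a != 0, t b != 0 & q = a + b].
Proof. exact: hmul_neq0. Qed.

Lemma hmonoM c d q r : hmono c q * hmono d r = hmono (c * d) (q + r).
Proof.
apply/hahnP => x; rewrite [LHS](@hmul_funE _ _ _ [set q]); last first.
  by move=> a /hmono_neq0->.
rewrite fsbig_set1 /= /hmono_fun eqxx subr_eq (addrC r).
by case: eqP; rewrite ?mulr0.
Qed.

Lemma hmono_pow c q n : hmono c q ^+ n = hmono (c ^+ n) (q *+ n).
Proof. by elim: n => // n IH; rewrite !exprS IH hmonoM mulrS. Qed.

Lemma hcoef_monoM c q s r : (hmono c q * s) r = c * s (r - q).
Proof.
rewrite [LHS](@hmul_funE _ _ _ [set q]); last first.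
  by move=> a /hmono_neq0->.
by rewrite fsbig_set1 /= /hmono_fun eqxx.
Qed.

Section Geometric.
(* 1 / (1 - t) for t with support bounded below by e > 0 *)
Variables (t : hahn k) (e : rat).
Hypotheses (e0 : 0 < e) (te : forall q, t q != 0 -> e <= q).

Lemma hcoefX_ge n q : (t ^+ n) q != 0 -> e *+ n <= q.
Proof.
elim: n q => [|n IH] q; first by rewrite expr0 hcoef1 mulr0n; have [->|] := eqVneq q 0; rewrite ?eqxx.
by rewrite exprS => /hcoefM_neq0[a [b [/te ea /IH eb ->]]]; rewrite mulrS lerD.
Qed.

Let N q := (Num.truncn (q / e)).+1.

Let Nle q n : (N q <= n)%N -> (t ^+ n) q = 0.
Proof.
move=> Nn; apply/eqP; apply: contraTT Nn => /hcoefX_ge enq.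
rewrite -ltnNge ltnS truncn_ge_nat; last first.
  by rewrite divr_ge0 ?(ltW e0)//; apply: le_trans enq; rewrite mulrn_wge0// ltW.
by rewrite ler_pdivlMr// mulr_natl.
Qed.

Definition hgeo_fun : rat -> k := fun q => (\sum_(i < N q) t ^+ i) q.

Let hgeo_sumE q n : (N q <= n)%N -> hgeo_fun q = (\sum_(i < n) t ^+ i) q.
Proof.
move=> Nn; rewrite /hgeo_fun -!(big_mkord xpredT (fun i => t ^+ i)).
rewrite [in RHS](big_cat_nat (n := N q))// hcoefD.
rewrite [X in _ = _ + X](_ : _ = 0) ?addr0// hcoef_sum big_nat_cond big1// => i.
by move=> /andP[/andP[Ni _] _]; exact: Nle.
Qed.

Let N_le q r : q <= r -> (N q <= N r)%N.
Proof. by move=> qr; rewrite ltnS le_truncn// ler_pM2r ?invr_gt0. Qed.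

Lemma hgeo_subproof : hgeo_fun \in @wo_supp k.
Proof.
apply/wo_suppP/well_ordered_local => x _.
apply: well_ordered_sub (@supp_wo (\sum_(i < N x) t ^+ i)) => q [sq /= qx].
by rewrite /supp /= -hgeo_sumE//; exact: N_le.
Qed.

Definition hgeo : hahn k := Hahn hgeo_subproof.

Lemma hgeoP : hgeo * (1 - t) = 1.
Proof.
rewrite mulrC; apply/hahnP => q.
transitivity (((1 - t) * \sum_(i < N q) t ^+ i) q).
  rewrite !hcoefM; apply: eq_fsbigr => a _.
  have [->|ta] := eqVneq ((1 - t) a) 0; first by rewrite !mul0r.
  congr (_ * _); apply: hgeo_sumE; apply: N_le; rewrite gerBl.
  move: ta; rewrite hcoefB hcoef1; have [->//|a0] := eqVneq a 0.
  by rewrite sub0r oppr_eq0 => /te/(le_trans (ltW e0)).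
have -> : (1 - t) * (\sum_(i < N q) t ^+ i) = 1 - t ^+ N q.
  by rewrite -[in RHS](expr1n _ (N q)) subrXX; congr (_ * _);
     apply: eq_bigr => i _; rewrite expr1n mul1r.
by rewrite hcoefB Nle// subr0.
Qed.

End Geometric.

Lemma hahn_lead s : s != 0 -> exists2 m, s m != 0 & forall q, s q != 0 -> m <= q.
Proof.
move=> s0; apply: (supp_wo (s := s)) => //.
apply/set0P; apply: contra s0 => /eqP s0; apply/eqP/hahnP => q; rewrite hcoef0.
apply/eqP; apply: contraT => sq.
by suff : @set0 rat q by []; rewrite -s0.
Qed.

Lemma hinv_ex s : s != 0 -> exists u, u * s = 1.
Proof.
move=> /hahn_lead[m sm sP].
pose t := 1 - hmono (s m)^-1 (- m) * s.
have tE q : t q = (q == 0)%:R - (s m)^-1 * s (q + m).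
  by rewrite /t hcoefB hcoef1 hcoef_monoM opprK.
have t0 q : t q != 0 -> 0 < q.
  rewrite tE lt_neqAle [0 == q]eq_sym; have [->|q0] /= := eqVneq q 0.
    by rewrite add0r mulVf// subrr eqxx.
  by rewrite sub0r oppr_eq0 mulf_eq0 => /norP[_ /sP]; rewrite lerDr.
have [e e0 te] : exists2 e, 0 < e & forall q, t q != 0 -> e <= q.
  have [->|/hahn_lead[e te tP]] := eqVneq t 0.
    by exists 1 => // q; rewrite hcoef0 eqxx.
  by exists e => //; exact: t0.
exists (hgeo e0 te * hmono (s m)^-1 (- m)).
have /= := hgeoP e0 te; rewrite {2}/t opprB addrC subrK mulrA.
by [].
Qed.

Definition hinv s := if s == 0 then 0 else xget 0 [set u | u * s = 1].

Lemma hmulVf s : s != 0 -> hinv s * s = 1.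
Proof.
move=> s0; rewrite /hinv (negPf s0).
by case: xgetP => [_ _ //|] H; have [u /H] := hinv_ex s0.
Qed.

Lemma hinv0 : hinv 0 = 0. Proof. by rewrite /hinv eqxx. Qed.

HB.instance Definition _ := GRing.ComNzRing_isField.Build (hahn k) hmulVf hinv0.

End HahnRing.

Section Valuation.
Variable k : fieldType.
Implicit Types s : hahn k.

Definition hval s : \bar rat :=
  if s == 0 then +oo%E else (xget 0 [set q | supp s q /\ lbound (supp s) q])%:E.

Definition valring : set (hahn k) := [set s | (0 <= hval s)%E].

Lemma hval0 : hval 0 = +oo%E. Proof. by rewrite /hval eqxx. Qed.

Lemma hval_fin s m : s m != 0 -> (forall q, s q != 0 -> m <= q) ->
  hval s = m%:E.
Proof.
move=> sm sP; rewrite /hval; case: eqP => [s0|_]; first by rewrite s0 hcoef0 eqxx in sm.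
congr (_%:E); case: xgetP => [_ -> [/= sx xP]|/(_ m) []]; last by split => //; exact: sP.
by apply/eqP; rewrite eq_le sP// andbT; exact: xP.
Qed.

Definition summable (F : nat -> hahn k) :=
  well_ordered (\bigcup_i supp (F i)) /\ forall q, finite_set [set i | F i q != 0].

(* Only meaningful when F is summable; otherwise the value is arbitrary. *)
Definition hsum (F : nat -> hahn k) : hahn k :=
  insubd 0 (fun q => \sum_(i \in [set: nat]) F i q).

(* Only used for m a power of the characteristic, in which case the root
   exists and is unique (k being algebraically closed). *)
Definition hroot (m : nat) s : hahn k := xget 0 [set t | t ^+ m = s].

Lemma hcoef_hsum F q : summable F ->
  hsum F q = \sum_(i \in [set: nat]) F i q.
Proof.
move=> [wo fin]; rewrite /hsum /insubd insubT //.
apply/wo_suppP; apply: well_ordered_sub wo => r Hr.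
have [i _ Hi] := fsbigN1 (f := fun (x : unit) i => F i r) (x := tt) Hr.
by exists i.
Qed.

End Valuation.

Arguments valring k : clear implicits.

Section CharP.
Variables (k : fieldType) (p : nat).
Hypothesis pk : p \in [pchar k].
Implicit Types s t : hahn k.

Let p_pr : prime p. Proof. exact: pcharf_prime pk. Qed.
Let p_gt0 : (0 < p)%N. Proof. exact: prime_gt0. Qed.
Let pQ_gt0 : 0 < p%:R :> rat. Proof. by rewrite ltr0n. Qed.

Lemma hcoefMn s n q : (s *+ n) q = s q *+ n.
Proof. by elim: n => // n IH; rewrite !mulrS hcoefD IH. Qed.

Lemma pchar_hahn : p \in [pchar hahn k].
Proof.
rewrite inE p_pr; apply/eqP/hahnP => q.
by rewrite hcoefMn hcoef1 mulrn_pchar.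
Qed.

Lemma hpexpD s t : (s + t) ^+ p = s ^+ p + t ^+ p.
Proof. by rewrite -!(pFrobenius_autE pchar_hahn) rmorphD. Qed.

Lemma hpexp_sum I (r : seq I) (f : I -> hahn k) :
  (\sum_(i <- r) f i) ^+ p = \sum_(i <- r) f i ^+ p.
Proof.
rewrite -(pFrobenius_autE pchar_hahn) rmorph_sum.
by apply: eq_bigr => i _; exact: pFrobenius_autE.
Qed.

Lemma hexpp_inj n : injective (fun s : hahn k => s ^+ (p ^ n)).
Proof.
elim: n => [|n IH] s t; first by rewrite expn0 !expr1.
rewrite expnSr !exprM -!(pFrobenius_autE pchar_hahn) => /fmorph_inj.
exact: IH.
Qed.

Fixpoint sumset n (S : set rat) : set rat := if n is m.+1 then
  [set q | exists a b, [/\ S a, sumset m S b & q = a + b]] else [set 0].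

Lemma sumset_wo n S : well_ordered S -> well_ordered (sumset n S).
Proof.
move=> woS; elim: n => [|n IH] /=; first exact: well_ordered1.
exact: well_orderedD.
Qed.

Lemma sumsetMn n S a : S a -> sumset n S (a *+ n).
Proof.
by move=> Sa; elim: n => [//|n IH] /=; exists a, (a *+ n); rewrite mulrS.
Qed.

Lemma sumsetS n S T : S `<=` T -> sumset n S `<=` sumset n T.
Proof.
move=> ST; elim: n => [//|n IH] q /= [a [b [Sa Sb ->]]].
by exists a, b; split; [exact: ST|exact: IH|].
Qed.

Lemma hcoefX_sumset n s q : (s ^+ n) q != 0 -> sumset n (supp s) q.
Proof.
elim: n q => [|n IH] q; first by rewrite expr0 hcoef1 /=; have [//|] := eqVneq q 0; rewrite eqxx.
rewrite exprS => /hcoefM_neq0[a [b [sa /IH sb ->]]].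
by exists a, b.
Qed.

Lemma hcoef_pexp s q : (s ^+ p) q = s (q / p%:R) ^+ p.
Proof.
pose E := [set a | supp s a /\ sumset p.-1 (supp s) (q - a)].
have fE : finite_set E.
  by apply: well_ordered_conv; [|apply: sumset_wo]; exact: supp_wo.
pose r := finite_support 0 E (fun a => s a).
have rP a : (a \in r) = `[< E a >].
  rewrite in_finite_support; last by apply: finite_setIl.
  apply/idP/asboolP => [|Ea]; first by rewrite inE => -[].
  by rewrite inE; split => //=; case: Ea => /= + _ => /eqP.
have r_uniq : uniq r by apply: finite_support_uniq.
pose sE : hahn k := \sum_(a <- r) hmono (s a) a.
have sEE a : sE a = if a \in r then s a else 0.
  rewrite /sE hcoef_sum; case: ifPn => ar.
    rewrite (bigD1_seq a)//= [X in X + _]/= /hmono_fun eqxx big1 ?addr0// => b.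
    by rewrite eq_sym => /negPf->.
  rewrite big1_seq// => b /andP[_ br] /=; rewrite /hmono_fun; case: eqP => // ab.
  by rewrite ab br in ar.
have sD : s = sE + (s - sE) by rewrite addrC subrK.
rewrite [in LHS]sD hpexpD hcoefD.
have -> : ((s - sE) ^+ p) q = 0.
  apply/eqP; apply: contraT => /hcoefX_sumset.
  rewrite -(prednK p_gt0) => -[a [b [sa sb qE]]].
  have sub : supp (s - sE) `<=` supp s.
    move=> c; rewrite /supp /mkset hcoefB sEE; case: ifP => _; first by rewrite subrr eqxx.
    by rewrite subr0.
  have ar : a \in r.
    rewrite rP; apply/asboolP; split; first exact: sub.
    by have -> : q - a = b; [rewrite qE; ring|apply: sumsetS sb].
  by move: sa; rewrite /supp /mkset hcoefB sEE ar subrr eqxx.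
rewrite addr0 /sE hpexp_sum hcoef_sum.
have qpE : q / p%:R *+ p = q by rewrite -mulr_natr divfK// gt_eqF.
rewrite (eq_bigr (fun a => if a == q / p%:R then s a ^+ p else 0)); last first.
  move=> a _; rewrite hmono_pow; congr (if _ then _ else _).
  apply/eqP/eqP => [->|-> //]; rewrite -[a *+ p]mulr_natr mulfK//.
  by rewrite gt_eqF.
have [qr|qr] := boolP (q / p%:R \in r).
  by rewrite (bigD1_seq (q / p%:R))//= eqxx big1 ?addr0// => b /negPf->.
rewrite big1_seq; last first.
  by move=> a /andP[_ ar]; case: eqP => // aE; rewrite -aE ar in qr.
suff -> : s (q / p%:R) = 0 by rewrite expr0n gtn_eqF.
apply/eqP; apply: contraNT qr => sq; rewrite rP; apply/asboolP; split => //.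
rewrite (_ : q - _ = (q / p%:R) *+ p.-1); first exact: sumsetMn.
by apply/eqP; rewrite subr_eq addrC -mulrS prednK// qpE.
Qed.

Lemma hcoef_pexpn n s q : (s ^+ (p ^ n)) q = s (q / (p ^ n)%:R) ^+ (p ^ n).
Proof.
elim: n s q => [|n IH] s q; first by rewrite expn0 !expr1 divr1.
rewrite expnSr exprM hcoef_pexp IH -exprM; congr (s _ ^+ _).
by rewrite natrM invfM mulrA mulrAC.
Qed.

Lemma artin_schreier_sum (F : nat -> hahn k) s :
    (forall n, F n ^+ (p ^ n) = s) -> (forall q, s q != 0 -> q < 0) ->
  let x := hsum (fun n => F n.+1) in
  [/\ summable (fun n => F n.+1), x ^+ p - x = s & forall q, x q != 0 -> q < 0].
Proof.
move=> FE s_neg x.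
have F0 : F 0 = s by rewrite -(FE 0) expn0 expr1.
have FS n : F n.+1 ^+ p = F n.
  by apply: (@hexpp_inj n); rewrite -exprM -expnS !FE.
have pn_gt0 n : 0 < (p ^ n)%:R :> rat by rewrite ltr0n expn_gt0 p_gt0.
have Fs n q : F n q != 0 -> s (q * (p ^ n)%:R) != 0.
  by rewrite -(FE n) hcoef_pexpn mulfK ?gt_eqF// => Fq; exact: expf_neq0.
have F_neg n q : F n q != 0 -> q < 0.
  by move=> /Fs/s_neg; rewrite pmulr_llt0.
have [m mP] : exists m, forall q, s q != 0 -> m <= q.
  have [->|/hahn_lead[m _ mP]] := eqVneq s 0; last by exists m.
  by exists 0 => q; rewrite hcoef0 eqxx.
pose M (q : rat) := (Num.truncn (m / q)).+1.
have FM n q r : r <= q -> q < 0 -> (M q <= n)%N -> F n r = 0.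
  move=> rq q0 Mn; apply/eqP; apply: contraTT Mn => /Fs/mP mle.
  rewrite -ltnNge ltnS.
  have nle : n%:R <= m / q.
    rewrite ler_ndivlMr//; apply: le_trans mle _.
    have rpn : r * (p ^ n)%:R <= q * (p ^ n)%:R by rewrite ler_pM2r.
    apply: le_trans rpn _; rewrite mulrC; apply: ler_wnM2r; first exact: ltW.
    by rewrite ler_nat ltnW// ltn_expl// prime_gt1.
  by rewrite truncn_ge_nat//; apply: le_trans nle; rewrite ler0n.
have F0' n q : 0 <= q -> F n q = 0.
  by move=> q0; apply/eqP; apply: contraTT q0 => /F_neg; rewrite -ltNge.
have F_ev q : exists N, forall n, (N <= n)%N -> F n q = 0.
  have [q0|q0] := ltP q 0; last by exists 0%N => n _; exact: F0'.
  by exists (M q) => n; exact: FM.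
have sumF : summable (fun n => F n.+1).
  split.
    apply: well_ordered_local => q [i _ /F_neg q0].
    apply: (@well_ordered_sub _ (\bigcup_(i in `I_(M q)) supp (F i.+1))).
      move=> r [[j _ Fj] /= rq]; exists j => //=.
      rewrite ltnNge; apply/negP => Mj.
      by move: Fj; rewrite /supp /= (FM _ q r)// ?eqxx// ltnW.
    by apply: well_ordered_bigcup => j _; exact: supp_wo.
  move=> q; have [N NP] := F_ev q.
  apply: (@sub_finite_set _ _ `I_N); last exact: finite_II.
  move=> n /=; apply: contraTT; rewrite -leqNgt => Nn.
  by rewrite NP ?eqxx// ltnW.
have fsumE (G : nat -> k) N : (forall n, (N <= n)%N -> G n = 0) ->
    \sum_(i \in [set: nat]) G i = \sum_(i < N) G i.
  move=> GN; rewrite fsbig_ord; apply/esym/fsbig_widen => // n [_ /= /negP].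
  by rewrite -leqNgt; exact: GN.
split => // [|q].
  apply/hahnP => q; rewrite hcoefB hcoef_pexp /x !hcoef_hsum//.
  have [N NP] := F_ev q; have [N' NP'] := F_ev (q / p%:R).
  pose L := maxn N N'.
  rewrite (fsumE _ L); last by move=> n Ln; apply: NP'; rewrite leqW// (leq_trans (leq_maxr _ _) Ln).
  rewrite (fsumE _ L); last by move=> n Ln; apply: NP; rewrite leqW// (leq_trans (leq_maxl _ _) Ln).
  rewrite -(pFrobenius_autE pk) rmorph_sum /=.
  under eq_bigr do rewrite pFrobenius_autE -hcoef_pexp FS.
  apply/eqP; rewrite subr_eq; apply/eqP.
  have <- : \sum_(i < L.+1) F i q = \sum_(i < L) F i q.
    by rewrite big_ord_recr -[RHS]addr0; congr (_ + _); exact: NP (leq_maxl _ _).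
  by rewrite big_ord_recl -F0.
rewrite /x hcoef_hsum// => Hq.
have [i _] := fsbigN1 (f := fun (x : unit) i => F i.+1 q) (x := tt) Hq.
exact: F_neg.
Qed.

End CharP.

Section Roots.
Variables (k : closedFieldType) (p : nat).
Hypothesis pk : p \in [pchar k].

Lemma hroot_ex n (s : hahn k) : exists t, t ^+ (p ^ n) = s.
Proof.
have p_gt0 : (0 < p)%N by apply: prime_gt0; exact: pcharf_prime pk.
have rootk (c : k) : exists r, r ^+ p = c.
  have [r rE] := solve_monicpoly (fun i => if i == 0%N then c else 0) p_gt0.
  exists r; rewrite rE -(prednK p_gt0) big_ord_recl /= expr0 mulr1 big1 ?addr0//.
  by move=> i _; rewrite mul0r.
elim: n s => [|n IH] s; first by exists s; rewrite expn0 expr1.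
suff [t <-] : exists t, t ^+ p = s.
  by have [u <-] := IH t; exists u; rewrite expnSr exprM.
pose rt c := xget 0 [set r : k | r ^+ p = c].
have rtE c : rt c ^+ p = c by rewrite /rt; case: xgetP => [_ _ //|]; have [r rc /(_ r)] := rootk c.
have pQ : 0 < p%:R :> rat by rewrite ltr0n.
have wo : (fun q => rt (s (p%:R * q))) \in @wo_supp k.
  apply/wo_suppP; apply: well_ordered_sub (well_ordered_scale pQ (supp_wo (s := s))).
  move=> q; apply: contra_neq => s0; have := rtE (s (p%:R * q)).
  by rewrite s0 => /eqP; rewrite expf_eq0 p_gt0 /= => /eqP.
exists (Hahn wo); apply/hahnP => q; rewrite (hcoef_pexp pk) /= rtE.
by rewrite mulrC divfK// gt_eqF.
Qed.

Lemma hrootP n (s : hahn k) : hroot (p ^ n) s ^+ (p ^ n) = s.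
Proof.
by rewrite /hroot; case: xgetP => [_ _ //|]; have [t ts /(_ t)] := hroot_ex n s.
Qed.

End Roots.

Section Series.
Variables (k : closedFieldType) (p : nat).

Definition alpha : hahn k := hsum (fun n => hmono 1 (- (p ^ n.+1)%:R^-1)).

Definition theta : hahn k := hsum (fun n => hroot (p ^ n.+1) alpha).

Definition eta : hahn k := hsum (fun n => hroot (p ^ n.+1) alpha ^+ 2).

Hypothesis pk : p \in [pchar k].

Let alphaP :
  [/\ summable (fun n => hmono (1 : k) (- (p ^ n.+1)%:R^-1)),
      alpha ^+ p - alpha = hmono 1 (-1) & forall q, alpha q != 0 -> q < 0].
Proof.
apply: (artin_schreier_sum pk (F := fun n => hmono 1 (- (p ^ n)%:R^-1))).
  move=> n; rewrite hmono_pow expr1n mulNrn; congr (hmono _ (- _)).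
  rewrite -[LHS]mulr_natr mulVf//.
  by rewrite pnatr_eq0 expn_eq0 negb_and; case: p (pcharf_prime pk).
by move=> q /hmono_neq0->.
Qed.

Let thetaP : [/\ summable (fun n => hroot (p ^ n.+1) alpha),
  theta ^+ p - theta = alpha & forall q, theta q != 0 -> q < 0].
Proof.
have [_ _ neg] := alphaP.
by apply: (artin_schreier_sum pk (F := fun n => hroot (p ^ n) alpha)) => // n;
   exact: hrootP.
Qed.

Let etaP : [/\ summable (fun n => hroot (p ^ n.+1) alpha ^+ 2),
  eta ^+ p - eta = alpha ^+ 2 & forall q, eta q != 0 -> q < 0].
Proof.
have [_ _ neg] := alphaP.
apply: (artin_schreier_sum pk (F := fun n => hroot (p ^ n) alpha ^+ 2)).
  by move=> n; rewrite exprAC hrootP.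
move=> q; rewrite expr2 => /hcoefM_neq0[a [b [/neg a0 /neg b0 ->]]].
by rewrite -(addr0 0) ltrD.
Qed.

Lemma summable_alpha : summable (fun n => hmono (1 : k) (- (p ^ n.+1)%:R^-1)).
Proof. by case: alphaP. Qed.

Lemma summable_theta : summable (fun n => hroot (p ^ n.+1) alpha).
Proof. by case: thetaP. Qed.

Lemma summable_eta : summable (fun n => hroot (p ^ n.+1) alpha ^+ 2).
Proof. by case: etaP. Qed.

Lemma alpha_eq : alpha ^+ p - alpha = hmono 1 (-1).
Proof. by case: alphaP. Qed.

Lemma theta_eq : theta ^+ p - theta = alpha.
Proof. by case: thetaP. Qed.

Lemma eta_eq : eta ^+ p - eta = alpha ^+ 2.
Proof. by case: etaP. Qed.

End Series.

Section Fields.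
Variable F : fieldType.
Implicit Types (K A : set F) (x : F) (f g : {poly F}).

Definition is_subfield K := divring_closed [in K].

(* K(A) *)
Definition adjoin K A : set F := smallest is_subfield (K `|` A).

(* The minimal polynomial of x over the subfield K. *)
Definition is_minpoly K x f :=
  [/\ f \is monic, f \is a polyOver [in K], root f x &
      forall g, g \is a polyOver [in K] -> g != 0 -> root g x ->
        (size f <= size g)%N].

(* deg_K x = n; no n qualifies when x is transcendental over K. *)
Definition has_degree K x n := exists2 f, is_minpoly K x f & size f = n.+1.

Definition perfect_subfield K := forall p, p \in [pchar F] ->
  forall x, K x -> exists2 z, K z & z ^+ p = x.

End Fields.

Section Depth.
Variable k : fieldType.
Implicit Types (K N : set (hahn k)) (zeta : hahn k).

(* k(y) *)
Definition ratfuns : set (hahn k) :=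
  adjoin (range (fun c => hmono c 0)) [set hmono 1 1].

(* Hensel's lemma holds in K: simple zeros modulo the maximal ideal lift. *)
Definition henselian K := forall (f : {poly hahn k}) (a : hahn k),
  f \is monic -> f \is a polyOver [in K `&` valring k] ->
  (K `&` valring k) a -> (0 < hval f.[a])%E -> hval f^`().[a] = 0%E ->
  exists2 b, (K `&` valring k) b & root f b /\ (0 < hval (b - a)%R)%E.

(* R is any model of the real numbers, with its norm topology. *)
Definition no_finite_limits (R : realType) K := forall a, K a ->
  limit_point ([set ratr q | q in supp a] : set R) = set0.

(* D_m(zeta); has_degree only holds for b algebraic over K. *)
Definition dist_set K zeta m : set (\bar rat) :=
  [set hval (zeta - b) | b in [set b | has_degree K b m]].

Definition next_degree K zeta d m := (d < m)%N /\
  exists2 e, dist_set K zeta m e & forall x, dist_set K zeta d x -> (x < e)%E.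

(* depth(zeta) = r: the sequence 1 = d_0 < ... < d_r = deg_K zeta is uniquely
   determined by zeta, and it stops exactly when it reaches deg_K zeta, since
   D_(deg_K zeta)(zeta) contains +oo while no D_m with m smaller does. *)
Definition is_depth K zeta r := exists d : nat -> nat,
  [/\ d 0%N = 1%N, has_degree K zeta (d r) & forall l, (l < r)%N ->
      next_degree K zeta (d l) (d l.+1) /\
      forall m, next_degree K zeta (d l) m -> (d l.+1 <= m)%N].

(* min {depth(zeta) | N = K(zeta)} = r *)
Definition is_ext_depth K N r :=
  (exists2 zeta, N = adjoin K [set zeta] & is_depth K zeta r) /\
  forall zeta s, N = adjoin K [set zeta] -> is_depth K zeta s -> (r <= s)%N.

End Depth.

Arguments ratfuns k : clear implicits.

(* Main.v *)
From HB Require Import structures.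
Require Import Defs.
From mathcomp Require Import all_boot all_order all_algebra all_fingroup all_field.
From mathcomp Require Import all_classical all_reals topology normedtype.
From mathcomp Require Import ring lra.

(** The Galois group of N/K acts by alpha |-> alpha + i, theta |-> theta + c,
eta |-> eta + 2 i theta + d with i, c, d in k. It is not commutative, because
neither alpha nor any theta - l alpha with l in k lies in K (their supports
accumulate at 0), and suitable commutators are non-trivial translations of eta.

Depth at most 2: take zeta = eta + kap theta with kap in k outside the prime
field. Since alpha^(1/p^n) = alpha - sum_(m <= n) y^(-1/p^m), the series zeta is
approximated by elements of K up to valuations just below -1/p^2, and by elements
of degree p of K(alpha) up to negative valuations arbitrarily close to 0. By
Krasner's argument, v(zeta - b) >= -1/p^2 forces alpha in K(b), and
v(zeta - b) >= 0 forces zeta in K(b).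

Depth at least 2: if zeta generates N and has depth 1, then any approximation of
zeta in a proper subfield is matched by one in K. For the commutator tau, a trace
argument over the fixed field of tau approximates zeta up to valuations just below
q = v(tau zeta - zeta); so v(s zeta - zeta) >= q for all s, and the coefficient of
y^q in s zeta - zeta is an additive character of the Galois group that does not
vanish on the commutator tau.

Conjugates of arbitrary algebraic elements are available inside the Hahn field
because it is algebraically closed, and Hensel's lemma makes v invariant under
the Galois group. *)

Set Implicit Arguments.
Unset Strict Implicit.
Unset Printing Implicit Defensive.
Import Order.TTheory GRing.Theory Num.Theory.
Import numFieldNormedType.Exports.

Local Open Scope classical_set_scope.
Local Open Scope ring_scope.

(** Both sides are the trinomial coefficient for parts of sizes i, m and j. It supplies the factor
    by which normalized derivatives compose in [c_shift]. *)
Lemma mul_bin_revision i m j :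
  ('C(i + m + j, i) * 'C(m + j, m) = 'C(i + m + j, i + m) * 'C(i + m, i))%N.
Proof.
apply/eqP; rewrite -(eqn_pmul2r (fact_gt0 i)) -(eqn_pmul2r (fact_gt0 m)).
rewrite -(eqn_pmul2r (fact_gt0 j)).
have := bin_fact (leq_addr (m + j) i); have := bin_fact (leq_addr j m).
have := bin_fact (leq_addr j (i + m)); have := bin_fact (leq_addr m i).
rewrite !addKn !addnA => E1 E2 E3 E4; apply/eqP.
transitivity ('C(i + m + j, i) * (i`! * ('C(m + j, m) * (m`! * j`!))))%N; first by ring.
by rewrite E3 E4 -E2 -E1; ring.
Qed.

(** * Valuation bounds and leading coefficients *)

Section Valuation.
Variable k : fieldType.
Implicit Types (x y z : hahn k) (q r : rat).

(** [vge q x] and [vgt q x] encode v(x) >= q and v(x) > q through coefficients, so that x = 0 needs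
    no separate case; [hval_ge] and [hval_gt] link them to [hval]. *)
Definition vge q x := forall r, r < q -> x r = 0.

Definition vgt q x := vge q x /\ x q = 0.

Lemma vge0 q : vge q (0 : hahn k). Proof. by []. Qed.

Lemma vgeD q x y : vge q x -> vge q y -> vge q (x + y).
Proof. by move=> vx vy r rq; rewrite hcoefD vx ?vy ?addr0. Qed.

Lemma vgeN q x : vge q x -> vge q (- x).
Proof. by move=> vx r rq; rewrite hcoefN vx ?oppr0. Qed.

Lemma vgeB q x y : vge q x -> vge q y -> vge q (x - y).
Proof. by move=> vx vy; apply/vgeD => //; apply/vgeN. Qed.

Lemma vge_sum q I (s : seq I) (P : pred I) (F : I -> hahn k) :
  (forall i, P i -> vge q (F i)) -> vge q (\sum_(i <- s | P i) F i).
Proof. by move=> H; elim/big_ind: _ => //; exact: vgeD. Qed.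

Lemma vge_le q r x : q <= r -> vge r x -> vge q x.
Proof. by move=> qr vx s /lt_le_trans/(_ qr)/vx. Qed.

Lemma vgeM q r x y : vge q x -> vge r y -> vge (q + r) (x * y).
Proof.
move=> vx vy s sqr; apply/eqP; apply: contraTT isT => /hcoefM_neq0[a [b [xa yb sE]]].
have qa : q <= a by rewrite leNgt; apply: contraNN xa => /vx->.
have rb : r <= b by rewrite leNgt; apply: contraNN yb => /vy->.
by move: sqr; rewrite sE ltNge lerD.
Qed.

(** Exponents a >= q and b >= r with a + b = q + r must be q and r themselves, so the convolution
    has a single term. *)
Lemma hcoefM_lead q r x y : vge q x -> vge r y -> (x * y) (q + r) = x q * y r.
Proof.
move=> vx vy; rewrite [LHS](@hmul_funE _ x y _ [set q]); last first.
  move=> a xa yqra; apply/eqP; rewrite eq_le; apply/andP; split.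
    have : r <= q + r - a by rewrite leNgt; apply: contraNN yqra => /vy->.
    by rewrite lerBrDr addrC lerD2r.
  by rewrite leNgt; apply: contraNN xa => /vx->.
by rewrite fsbig_set1 addrAC subrr add0r.
Qed.

Lemma vge_hmono (c : k) q : vge q (hmono c q).
Proof. by move=> r rq; rewrite /= /hmono_fun lt_eqF. Qed.

Lemma hcoef_hmono (c : k) q : hmono c q q = c.
Proof. by rewrite /= /hmono_fun eqxx. Qed.

Lemma vge1 : vge 0 (1 : hahn k). Proof. exact: vge_hmono. Qed.

Lemma hcoef10 : (1 : hahn k) 0 = 1. Proof. exact: hcoef_hmono. Qed.

Lemma vgeX q x n : vge q x -> vge (q *+ n) (x ^+ n).
Proof.
move=> vx; elim: n => [|n IH]; first exact: vge1.
by rewrite exprS mulrS; exact: vgeM.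
Qed.

Lemma hcoefX_lead q x n : vge q x -> (x ^+ n) (q *+ n) = x q ^+ n.
Proof.
move=> vx; elim: n => [|n IH]; first exact: hcoef10.
by rewrite !exprS mulrS hcoefM_lead// ?IH//; exact: vgeX.
Qed.

Lemma vge_prod I (s : seq I) (P : pred I) (F : I -> hahn k) (q : I -> rat) :
    (forall i, P i -> vge (q i) (F i)) ->
  vge (\sum_(i <- s | P i) q i) (\prod_(i <- s | P i) F i).
Proof.
move=> H; elim/big_rec2: _ => [|i x y Pi v]; first exact: vge1.
by apply: vgeM => //; exact: H.
Qed.

Lemma vgeMn q x n : vge q x -> vge q (x *+ n).
Proof. by move=> vx; elim: n => // n IH; rewrite mulrS; exact: vgeD. Qed.

Lemma vge_lead x : x != 0 -> exists2 q, x q != 0 & vge q x.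
Proof.
move=> /hahn_lead[q xq H]; exists q => // r; rewrite ltNge => H'.
by apply/eqP; apply: contraNT H' => /H.
Qed.

Lemma vge_neq0 q r x : x q != 0 -> vge r x -> r <= q.
Proof. by move=> xq vx; rewrite leNgt; apply: contraNN xq => /vx->. Qed.

Lemma vgtW q x : vgt q x -> vge q x. Proof. by case. Qed.

(** A nonzero series has a least exponent, so a strict bound always leaves a gap above q. *)
Lemma vgtE q x : vgt q x <-> exists2 r, q < r & vge r x.
Proof.
split=> [[vx xq]|[r qr vx]]; last first.
  by split; [exact: vge_le (ltW qr) vx|exact: vx].
have [->|/vge_lead[r xr vr]] := eqVneq x 0.
  by exists (q + 1); rewrite ?ltrDl.
exists r => //; rewrite lt_neqAle (vge_neq0 xr vx) andbT.
by apply: contraNneq xr => <-; rewrite xq.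
Qed.

Lemma vgt_le q r x : q <= r -> vgt r x -> vgt q x.
Proof.
by move=> qr /vgtE[s rs vx]; apply/vgtE; exists s => //; exact: le_lt_trans rs.
Qed.

Lemma vge_lt q r x : q < r -> vge r x -> vgt q x.
Proof. by move=> qr vx; apply/vgtE; exists r. Qed.

Lemma vgtD q x y : vgt q x -> vgt q y -> vgt q (x + y).
Proof. by move=> [vx xq] [vy yq]; split; [exact: vgeD|rewrite hcoefD xq yq addr0]. Qed.

Lemma vgtN q x : vgt q x -> vgt q (- x).
Proof. by move=> [vx xq]; split; [exact: vgeN|rewrite hcoefN xq oppr0]. Qed.

Lemma vgtB q x y : vgt q x -> vgt q y -> vgt q (x - y).
Proof. by move=> vx vy; apply/vgtD => //; apply/vgtN. Qed.

Lemma vgt_sum q I (s : seq I) (P : pred I) (F : I -> hahn k) :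
  (forall i, P i -> vgt q (F i)) -> vgt q (\sum_(i <- s | P i) F i).
Proof. by move=> H; elim/big_ind: _ => //; exact: vgtD. Qed.

Lemma vgtMl q r x y : vgt q x -> vge r y -> vgt (q + r) (x * y).
Proof.
move=> /vgtE[s qs vx] vy; apply/vgtE; exists (s + r); first by rewrite ltrD2r.
exact: vgeM.
Qed.

Lemma vgeV q x : x q != 0 -> vge q x -> vge (- q) x^-1 /\ x^-1 (- q) = (x q)^-1.
Proof.
move=> xq vx; have x0 : x != 0 by apply: contraNneq xq => ->.
have [s ys vy] : exists2 s, x^-1 s != 0 & vge s x^-1.
  by apply: vge_lead; rewrite invr_eq0.
have := hcoefM_lead vx vy; rewrite divff// hcoef1.
have [E|_] := eqVneq (q + s) 0; last first.
  by move=> /esym/eqP; rewrite mulf_eq0 (negPf xq) (negPf ys).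
have -> : - q = s by apply/eqP; rewrite eq_sym -addr_eq0 addrC E.
by move=> E1; split => //; apply: (mulfI xq); rewrite -E1 divff.
Qed.

Lemma hval_fin' q x : x q != 0 -> vge q x -> hval x = q%:E.
Proof. by move=> xq vx; apply: hval_fin => // r; move/vge_neq0; exact. Qed.

Lemma hval_ge q x : (q%:E <= hval x)%E <-> vge q x.
Proof.
have [->|] := eqVneq x 0; first by rewrite hval0 leey.
move=> /vge_lead[r xr vx]; rewrite (hval_fin' xr vx) lee_fin; split.
  by move=> /vge_le; exact.
exact: vge_neq0.
Qed.

Lemma hval_gt q x : (q%:E < hval x)%E <-> vgt q x.
Proof.
have [->|] := eqVneq x 0; first by rewrite hval0 ltey.
move=> /vge_lead[r xr vx]; rewrite (hval_fin' xr vx) lte_fin; split.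
  by move=> /vge_lt; exact.
by move=> /vgtE[s qs /(vge_neq0 xr)]; exact: lt_le_trans.
Qed.

Lemma hval_eq0 x : hval x = 0%E <-> vge 0 x /\ x 0 != 0.
Proof.
split=> [H|[vx x0]]; last exact: hval_fin'.
have vx : vge 0 x by apply/hval_ge; rewrite H.
split => //; apply/negP => /eqP x0.
by have /hval_gt : vgt 0 x by []; rewrite H ltxx.
Qed.

End Valuation.

(** * The Hahn field over an algebraically closed field is algebraically closed *)

Section AlgClosed.
Variables (k : closedFieldType) (f : {poly hahn k}).
Hypotheses (f_size : (1 < size f)%N) (f_noroot : forall x, f.[x] != 0).
Implicit Types (x h : hahn k) (r : rat).

(** The Taylor coefficients at x: f(x + T) is the sum of the [c x j] T^j. *)
Let c x j := f^`N(j).[x].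

Let n := size f.

Let c_big x j : (n <= j)%N -> c x j = 0.
Proof. by move=> nj; rewrite /c nderivn_poly0// horner0. Qed.

Let c_shift x h i : c (x + h) i = \sum_(m < n) c x (i + m) * h ^+ m *+ 'C(i + m, i).
Proof.
rewrite /c (@nderiv_taylor_wide _ n); last 2 first.
- exact: mulrC.
- apply: leq_trans (size_poly _ _) (leq_subr _ _).
apply: eq_bigr => m _; 
suff -> : (f^`N(i))^`N(m) = f^`N(i + m) *+ 'C(i + m, i).
  by rewrite hornerMn mulrnAl.
apply/polyP => j; rewrite coefMn !coef_nderivn -!mulrnA addnA; congr (_ *+ _).
exact: mul_bin_revision.
Qed.

(* [good x r]: [-r] is the largest slope of the Newton polygon of [f(x + T)],
   so that [x] may be improved by a monomial of exponent [r]. *)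
Let goodv x r v := [/\ c x 0 v != 0, forall j, vge (v - r *+ j) (c x j) &
  exists2 j, (0 < j)%N & c x j (v - r *+ j) != 0].

Let good x r := exists v, goodv x r v.

Let good_ex x : exists r, good x r.
Proof.
have [v cv vv] : exists2 v, c x 0 v != 0 & vge v (c x 0).
  by apply: vge_lead; rewrite /c nderivn0.
have val j : exists w, c x j != 0 -> c x j w != 0 /\ vge w (c x j).
  have [_|/vge_lead[w]] := eqVneq (c x j) 0; first by exists 0.
  by exists w.
have [w wP] := choice val.
pose P (j : 'I_n) := (0 < j)%N && (c x j != 0).
(* [s j] is minus the slope of the segment from (0, v) to (j, w j). With r its maximum, no point
   lies below the line of slope -r through (0, v), and a maximizing index lies on it. *)
pose s (j : 'I_n) := (v - w j) / j%:R.
have f0 : f != 0 by rewrite -size_poly_gt0; apply: ltnW.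
have n1 : (n.-1 < n)%N by rewrite prednK// ltnW.
have P0 : P (Ordinal n1).
  rewrite /P /= -ltnS prednK ?f_size//=; last exact: ltnW.
  have := @nderivn_def _ n.-1 f.
  have E : f^`N(n.-1) = (lead_coef f)%:P.
    apply/polyP => -[|i]; rewrite coef_nderivn coefC /=.
      by rewrite addn0 binn mulr1n lead_coefE.
    rewrite nth_default ?mul0rn// addnS -addSn prednK ?leq_addr//.
    exact: ltnW.
  by rewrite /c E hornerC lead_coef_eq0.
case: (arg_maxP s P0) => i /andP[i0 ci] imax.
exists (s i), v; split => //; last first.
  exists i => //; rewrite /s -[_ *+ i]mulr_natr divfK ?pnatr_eq0 -?lt0n//.
  by rewrite subKr; have [] := wP i ci.
move=> j; have [->|cj] := eqVneq (c x j) 0 => //.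
have [->|j0] := posnP j; first by rewrite mulr0n subr0.
have jn : (j < n)%N by rewrite ltnNge; apply: contraNN cj => /c_big->.
have [_] := wP j cj; apply: vge_le.
have /= := imax (Ordinal jn); rewrite /P /= j0 cj => /(_ isT).
rewrite {1}/s /= ler_pdivrMr ?ltr0n// mulr_natr => H.
by rewrite lerBlDr addrC -lerBlDr.
Qed.

(** The last index j on the edge is singled out because its leading coefficient survives every shift
    of x by a series of valuation at least r. *)
Let good_top x r v : goodv x r v -> exists j, [/\ (0 < j)%N,
  c x j (v - r *+ j) != 0 & forall m, (j < m)%N -> c x m (v - r *+ m) = 0].
Proof.
move=> [_ _ [j0 j0p cj0]].
pose P j := (0 < j)%N && (c x j (v - r *+ j) != 0).
have exP : exists j, P j by exists j0; rewrite /P j0p.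
have bP j : P j -> (j <= n)%N.
  move=> /andP[_]; apply: contraNT; rewrite -ltnNge => /ltnW/c_big->.
  by rewrite hcoef0.
case: (ex_maxnP exP bP) => j /andP[jp cj] jmax; exists j; split => // m jm.
apply/eqP; apply: contraT => cm; move: (jm); rewrite ltnNge jmax//.
by rewrite /P cm (leq_ltn_trans _ jm).
Qed.

Let shift_vge x h r v i : goodv x r v -> vge r h ->
  vge (v - r *+ i) (c (x + h) i).
Proof.
move=> [_ vc _] vh; rewrite c_shift; apply: vge_sum => m _; apply: vgeMn.
have -> : v - r *+ i = v - r *+ (i + m) + r *+ m by rewrite mulrnDr; ring.
by apply: vgeM => //; exact: vgeX.
Qed.

Let shift_coef x h r v i : goodv x r v -> vge r h ->
  c (x + h) i (v - r *+ i) =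
    \sum_(m < n) c x (i + m) (v - r *+ (i + m)) * h r ^+ m *+ 'C(i + m, i).
Proof.
move=> [_ vc _] vh; rewrite c_shift hcoef_sum; apply: eq_bigr => m _.
rewrite hcoefMn; congr (_ *+ _).
have -> : v - r *+ i = v - r *+ (i + m) + r *+ m by rewrite mulrnDr; ring.
by rewrite hcoefM_lead ?hcoefX_lead//; exact: vgeX.
Qed.

(** The point of the top index j stays on the old line, which gives w - r' j <= v - r j. Since v <=
    w, it follows that r <= r'; if the coefficient of f(y) at v vanishes, then v < w and the
    inequality is strict. *)
Let good_mono x r y r' v w : goodv x r v -> goodv y r' w -> vge r (y - x) ->
  (r <= r') /\ (c y 0 v = 0 -> r < r').
Proof.
move=> gx gy vh; have yE : y = x + (y - x) by ring.
have [j [jp cj cj0]] := good_top gx.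
have vw : v <= w.
  have := @shift_vge _ _ _ _ 0 gx vh; rewrite -yE mulr0n subr0 => vy.
  by case: gy => cw _ _; exact: vge_neq0 cw vy.
have cyj : c y j (v - r *+ j) != 0.
  have := @shift_coef _ _ _ _ j gx vh; rewrite -yE => ->.
  have n0 : (0 < n)%N by apply: ltnW.
  rewrite (bigD1 (Ordinal n0))//= addn0 expr0 mulr1 binn mulr1n big1 ?addr0// => m.
  rewrite -val_eqE /= -lt0n => m0.
  by rewrite cj0 ?mul0r ?mul0rn// -[X in (X < _)%N]addn0 ltn_add2l.
have wv : w - r' *+ j <= v - r *+ j.
  by case: gy => _ vy _; exact: vge_neq0 cyj (vy j).
have jQ : 0 < j%:R :> rat by rewrite ltr0n.
move: wv; rewrite -[r' *+ j]mulr_natr -[r *+ j]mulr_natr => wv; split.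
  by rewrite -(ler_pM2r jQ); lra.
move=> cv0; have {}vw : v < w.
  by rewrite lt_neqAle vw andbT; case: gy => cw _ _; apply: contraNneq cw => <-; rewrite cv0.
by rewrite -(ltr_pM2r jQ); lra.
Qed.

Let good_step x r : good x r -> exists y r', [/\ good y r', vge r (y - x) & r < r'].
Proof.
(* [g] is the residue polynomial of the edge. It is not constant, because of the index j > 0, and
   for a root a of it the shift by a y^r cancels the coefficient of f(x) at v. *)
move=> [v gx]; pose g : {poly k} := \poly_(m < n) c x m (v - r *+ m).
have [j [jp cj _]] := good_top gx.
have jn : (j < n)%N.
  by rewrite ltnNge; apply: contraNN cj => /c_big->.
have sg : size g != 1%N.
  apply/eqP => sg; have : g`_j = 0 by rewrite nth_default// sg.
  by rewrite coef_poly jn => /eqP; apply/negP.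
have [a /rootP ga] := closed_rootP _ sg.
pose h := hmono a r; have vh : vge r h by exact: vge_hmono.
have [r' [w gy]] := good_ex (x + h).
have xh : x + h - x = h by ring.
have := @good_mono _ _ _ _ _ _ gx gy; rewrite xh => /(_ vh)[_ lt].
exists (x + h), r'; split; [by exists w|by rewrite xh|apply: lt].
have := @shift_coef _ _ _ _ 0 gx vh; rewrite mulr0n subr0 => ->.
rewrite -[RHS]ga horner_poly; apply: eq_bigr => m _.
by rewrite add0n bin0 mulr1n hcoef_hmono.
Qed.

Let T := {xr : hahn k * rat | `[< good xr.1 xr.2 >]}.
Let R (s t : T) : bool :=
  `[< (val s).2 <= (val t).2 /\ vge (val s).2 ((val t).1 - (val s).1) >].

(** In the order [R], a larger pair (x, r) agrees with a smaller one below the precision of the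
    smaller. A chain without a largest member is glued coefficientwise, and [good_mono] bounds the
    precision of the result from below. *)
Let chain_bound (A : set T) : total_on A R -> exists t, forall s, A s -> R s t.
Proof.
move=> totA; have [[t At tmax]|nomax] :=
  pselect (exists2 t, A t & forall s, A s -> R s t); first by exists t.
have up s : A s -> exists2 t, A t & (val s).2 < (val t).2 /\ R s t.
  move=> As; apply: contrapT => H; apply: nomax; exists s => // t At.
  have [Rst|//] := totA s t As At.
  have [le_st vst] := asboolP _ Rst.
  have E : (val s).2 = (val t).2.
    apply/eqP; rewrite eq_le le_st leNgt; apply/negP => lt; apply: H.
    by exists t.
  apply/asboolP; rewrite -E; split => //.
  by rewrite -opprB; exact: vgeN.
(* All members of the chain whose precision exceeds q share their coefficient at q, so the choice
   made by [xget] does not matter; the default 0 serves the exponents beyond all precisions. *)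
pose sel (q : rat) : set (hahn k) :=
  [set x | exists2 t, A t & x = (val t).1 /\ q < (val t).2].
have selE q t : A t -> q < (val t).2 -> xget 0 (sel q) q = (val t).1 q.
  move=> At qt; case: xgetP => [x _ [s As [-> qs]]|/(_ (val t).1) []]; last by exists t.
  have [/asboolP[_ v]|/asboolP[_ v]] := totA s t As At.
    by have := v q qs; rewrite hcoefB => /eqP; rewrite subr_eq0 => /eqP.
  by have := v q qt; rewrite hcoefB => /eqP; rewrite subr_eq0 => /eqP.
have wo : (fun q => xget 0 (sel q) q) \in @wo_supp k.
  apply/wo_suppP/well_ordered_local => q.
  rewrite /supp /= => xq0.
  have [t At qt] : exists2 t, A t & q < (val t).2.
    by move: xq0; case: xgetP => [x _ [s As [_ qs]]|]; [exists s|rewrite eqxx].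
  apply: well_ordered_sub (@supp_wo _ (val t).1) => r [/= + rq].
  by rewrite /supp /= (selE _ t)//; exact: le_lt_trans qt.
pose y := Hahn wo.
have vy t : A t -> vge (val t).2 (y - (val t).1).
  by move=> At q qt; rewrite hcoefB /= (selE _ t)// subrr.
have [r [w gy]] := good_ex y.
have gyr : `[< good y r >] by apply/asboolP; exists w.
exists (exist _ (y, r) gyr) => s As; apply/asboolP; split => /=; last exact: vy.
have /asboolP[v gs] := valP s.
by have [] := good_mono gs gy (vy s As).
Qed.

(** Zorn's lemma gives a maximal approximation, which [good_step] improves. *)
Lemma hahn_root_contra : False.
Proof.
have [r0 /asboolP g0] := good_ex 0.
have [||t tmax] := @ZL_preorder T (exist _ (0, r0) g0) R _ _ chain_bound.
- by move=> t; apply/asboolP; rewrite lexx subrr.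
- move=> r s t /asboolP[rs vrs] /asboolP[st vst]; apply/asboolP; split.
    exact: le_trans st.
  have -> : (val t).1 - (val r).1 = (val t).1 - (val s).1 + ((val s).1 - (val r).1) by ring.
  by apply: vgeD => //; exact: vge_le vst.
have /asboolP gt := valP t.
have [y [r' [/asboolP gy vy lt]]] := good_step gt.
have /tmax/asboolP[/= + _] : R t (exist _ (y, r') gy).
  by apply/asboolP; split => //=; exact: ltW.
by rewrite leNgt lt.
Qed.

End AlgClosed.

Lemma hahn_closed (k : closedFieldType) (f : {poly hahn k}) :
  (1 < size f)%N -> exists x, root f x.
Proof.
move=> sf; apply: contrapT => H; apply: (hahn_root_contra sf) => x.
by apply/negP => fx; apply: H; exists x.
Qed.

(** * Galois extensions embedded in an algebraically closed field *)

Section GaloisClosure.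
Variables (F E : fieldType) (iota : {rmorphism F -> E}).
Implicit Types (q r : {poly F}) (x y : E).

Local Notation "q ^ f" := (map_poly f q) : ring_scope.

(** Only exponents divisible by p occur in q, and its coefficients have p-th roots, so Frobenius
    gives the root h. *)
Lemma deriv0_pth_power p q :
    p \in [pchar F] -> (forall a : F, exists b, b ^+ p = a) -> q^`() = 0 ->
  exists h, q = h ^+ p.
Proof.
move=> pF pth q'0; have [b bP] := choice pth.
have p_gt0 : (0 < p)%N by apply: prime_gt0; exact: pcharf_prime pF.
have qp i : ~~ (p %| i)%N -> q`_i = 0.
  case: i => [|i]; first by rewrite dvdn0.
  move=> pi; have : q^`()`_i = 0 by rewrite q'0 coef0.
  move=> /eqP; rewrite coef_deriv -mulr_natr mulf_eq0 => /orP[/eqP//|].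
  by rewrite -(dvdn_pcharf pF) (negPf pi).
pose h := \poly_(i < size q) b q`_(i * p).
have pFX : p \in [pchar {poly F}] by rewrite pchar_poly.
exists h; rewrite -(pFrobenius_autE pFX) /h poly_def rmorph_sum /=.
apply/polyP => j; rewrite coef_sum.
under eq_bigr => i _.
  rewrite pFrobenius_autE exprZn bP -exprM coefZ coefXn; over.
have [pj|pj] := boolP (p %| j)%N; last first.
  rewrite qp// big1// => i _; case: eqP => [ij_eq|_]; last by rewrite mulr0.
  by rewrite ij_eq dvdn_mull in pj.
have jE := divnK pj; have [sj|sj] := leqP (size q) (j %/ p).
  rewrite nth_default; last by apply: leq_trans sj _; exact: leq_div.
  rewrite big1// => i _; case: eqP => [ij_eq|_]; last by rewrite mulr0.
  by move: (ltn_ord i); rewrite ltnNge -(mulnK i p_gt0) -ij_eq sj.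
rewrite (bigD1 (Ordinal sj))//= jE eqxx mulr1 big1 ?addr0// => i.
rewrite -val_eqE /= => ij; case: eqP => [ij_eq|_]; last by rewrite mulr0.
by rewrite ij_eq mulnK ?eqxx in ij.
Qed.

(** A polynomial of least size vanishing at x is separable: otherwise a p-th root of q (if q' = 0),
    the gcd of q and q', or its cofactor would be smaller and still vanish at x. *)
Lemma perfect_separable p x q :
    p \in [pchar F] -> (forall a : F, exists b, b ^+ p = a) ->
    q != 0 -> root (q ^ iota) x ->
  exists2 r, separable_poly r & root (r ^ iota) x.
Proof.
move=> pF pth; have [n] := ubnP (size q); elim: n q => // n IH q sq q0 qx.
have [[r [rq r0 rx]]|q_min] := pselect (exists r,
  [/\ (size r < size q)%N, r != 0 & root (r ^ iota) x]).
  by apply: (IH r) => //; rewrite ltnS in sq; exact: leq_trans rq sq.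
have p_gt1 : (1 < p)%N by apply: prime_gt1; exact: pcharf_prime pF.
have q_gt1 : (1 < size q)%N.
  by rewrite -(size_map_poly iota); apply: root_size_gt1 qx; rewrite map_poly_eq0.
exists q => //; have [q'0|q'0] := eqVneq q^`() 0.
  exfalso; have [h qE] := deriv0_pth_power pF pth q'0; apply: q_min; exists h.
  have h0 : h != 0 by apply: contraNneq q0 => h0; rewrite qE h0 expr0n gtn_eqF// ltnW.
  split => //; last first.
    by move: qx; rewrite qE rmorphXn /= /root horner_exp expf_eq0 => /andP[].
  have := size_exp h p; rewrite -qE (polySpred q0) (polySpred h0) /= => ->.
  rewrite ltnS ltn_Pmulr//.
  move: q_gt1; rewrite (polySpred q0) ltnS qE.
  by rewrite size_exp; case: (size h).-1 => //; rewrite mul0n.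
rewrite separable_poly.unlock /coprimep; apply: contraT => gN1.
have g_gt1 : (1 < size (gcdp q q^`()))%N.
  by rewrite ltn_neqAle eq_sym gN1 size_poly_gt0 gcdp_eq0 negb_and q0.
exfalso; apply: q_min; have := divpK (dvdp_gcdl q q^`()).
set g := gcdp _ _ in g_gt1 *; set h := q %/ g => qE.
have g0 : g != 0 by rewrite -size_poly_gt0 ltnW.
have h0 : h != 0 by apply: contraNneq q0 => h0; rewrite -qE h0 mul0r.
have : root (h ^ iota * g ^ iota) x by rewrite -rmorphM qE.
rewrite rootM => /orP[hx|gx].
  exists h; split => //; rewrite -qE size_mul// (polySpred h0) (polySpred g0).
  rewrite addSn addnS /= -addn1 leq_add2l.
  by move: g_gt1; rewrite (polySpred g0).
exists g; split => //; apply: leq_ltn_trans (lt_size_deriv q0).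
by apply: dvdp_leq => //; exact: dvdp_gcdr.
Qed.

Hypothesis E_closed : forall f : {poly E}, (1 < size f)%N -> exists x, root f x.
Hypothesis F_inf : forall n, exists s : seq F, uniq s /\ (n < size s)%N.

Lemma closed_poly_factors (f : {poly E}) : f != 0 ->
  exists s : seq E, f %= \prod_(x <- s) ('X - x%:P).
Proof.
have [n] := ubnP (size f); elim: n f => // n IH f sf f0.
have [f1|/E_closed[x /factor_theorem[g fE]]] := leqP (size f) 1.
  exists [::]; rewrite big_nil -size_poly_eq1 eqn_leq f1 size_poly_gt0 f0//.
have g0 : g != 0 by apply: contraNneq f0 => g0; rewrite fE g0 mul0r.
have [||s gs] := IH g => //.
  by move: sf; rewrite fE size_Mmonic ?monicXsubC// size_XsubC addn2 ltnS.
by exists (x :: s); rewrite big_cons fE mulrC eqp_mull.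
Qed.

Definition poly_of z x := exists q, (q ^ iota).[z] = x.

Lemma poly_of_trans y z x : poly_of y x -> poly_of z y -> poly_of z x.
Proof.
move=> [q <-] [r <-]; exists (q \Po r).
by rewrite map_comp_poly horner_comp.
Qed.

(** Iterated primitive element theorem over an infinite field. The expression of z as a linear
    combination of s is recorded because it later puts z into the field generated by the roots. *)
Lemma primitive_element_seq (s : seq E) :
    (forall x, x \in s -> exists2 q, separable_poly q & root (q ^ iota) x) ->
  exists z, [/\ forall x, x \in s -> poly_of z x,
    exists c : nat -> F, z = \sum_(i < size s) iota (c i) * s`_i &
    exists2 q, q != 0 & root (q ^ iota) z].
Proof.
elim: s => [_|y s IH sP].
  exists 0; split => //; first by exists (fun=> 0); rewrite big_ord0.
  by exists 'X; rewrite ?polyX_eq0// map_polyX rootX.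
have [|x [xs [c xE] [q q0 qx]]] := IH; first by move=> x xs; apply: sP; rewrite inE xs orbT.
have [r sepr ry] := sP y (mem_head _ _).
have [g g0 gP] := large_field_PET q0 qx ry sepr.
have [t gt] : exists t, ~~ root g (iota t).
  have [ts [ts_uniq sts]] := F_inf (size g).
  have : ~~ all (root g) (map iota ts).
    apply: contraL sts => gts; rewrite -leqNgt -(size_map iota) ltnW//.
    by apply: max_poly_roots => //; rewrite map_inj_uniq//; exact: fmorph_inj.
  by move=> /allPn[_ /mapP[t _ ->] gt]; exists t.
have [zx zy] := gP t gt; exists (iota t * y - x); split.
- move=> w; rewrite inE => /orP[/eqP-> //|/xs wx].
  exact: poly_of_trans zx.
- exists (fun i => if i is j.+1 then - c j else t).
  rewrite big_ord_recl /= xE -sumrN; congr (_ + _).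
  by apply: eq_bigr => i _; rewrite rmorphN mulNr.
- suff : algebraicOver iota (iota t * y - x) by [].
  apply: algebraic_sub; last by exists q.
  apply: algebraic_mul; first exact: algebraic_id.
  by exists r => //; exact: separable_poly_neq0.
Qed.

Lemma exists_minpoly z q : q != 0 -> root (q ^ iota) z ->
  exists m, [/\ m != 0, root (m ^ iota) z &
    forall r, root (r ^ iota) z -> r != 0 -> (size m <= size r)%N].
Proof.
have [n] := ubnP (size q); elim: n q => // n IH q sq q0 qz.
have [[r [rq r0 rz]]|q_min] := pselect (exists r,
  [/\ (size r < size q)%N, r != 0 & root (r ^ iota) z]).
  by apply: (IH r) => //; rewrite ltnS in sq; exact: leq_trans rq sq.
exists q; split => // r rz r0; rewrite leqNgt; apply/negP => rq.
by apply: q_min; exists r.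
Qed.

(** Let z be a primitive element for all roots in E of the product Q of [qs], with minimal
    polynomial m. Then L is F[X]/(m), embedded by X |-> z, and it is a splitting field of Q
    generated by separable elements. *)
Theorem galois_closure (qs : seq {poly F}) : all separable_poly qs ->
  exists (L : splittingFieldType F) (phi : {rmorphism L -> E}),
  [/\ forall a : F, phi a%:A = iota a,
      forall q x, q \in qs -> root (q ^ iota) x -> exists y : L, phi y = x &
      galois 1 {:L}].
Proof.
move=> /allP sep_qs; pose Q := \prod_(q <- qs) q.
have Q0 : Q != 0.
  by rewrite prodf_seq_neq0; apply/allP => q /sep_qs/separable_poly_neq0.
have [|s Qs] := @closed_poly_factors (Q ^ iota); first by rewrite map_poly_eq0.
have QsE x : (x \in s) = root (Q ^ iota) x.
  by rewrite (eqp_root Qs) root_prod_XsubC.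
have rootQ x : root (Q ^ iota) x = has (fun q => root (q ^ iota) x) qs.
  rewrite /Q rmorph_prod /=; elim: (qs) => [|q l IH]; first by rewrite big_nil (negPf (root1 x)).
  by rewrite big_cons rootM IH.
have sep_s x : x \in s -> exists2 q, separable_poly q & root (q ^ iota) x.
  by rewrite QsE rootQ => /hasP[q /sep_qs sq qx]; exists q.
have [z [zs [c zE] [q q0 qz]]] := primitive_element_seq sep_s.
have [m [m0 mz m_min]] := exists_minpoly q0 qz.
have irr_m : irreducible_poly m by apply/(subfx_irreducibleP mz m0).
pose L0 : fieldExtType F := SubFieldExtType mz irr_m.
pose phi : {rmorphism L0 -> E} := @subfx_inj F E iota z m.
have phiA (a : F) : phi a%:A = iota a by exact: subfx_inj_base.
have phi_root x : x \in s -> exists y : L0, phi y = x.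
  move=> /zs[r <-]; exists (subfx_eval iota z m r).
  exact: subfx_inj_eval.
have /choice[g gP] x : exists y : L0, x \in s -> phi y = x.
  by have [/phi_root[y yx]|_] := boolP (x \in s); [exists y|exists 0].
have gsE : map phi (map g s) = s by rewrite -map_comp map_id_in// => x; exact: gP.
have Qgs : Q ^ in_alg L0 %= \prod_(x <- map g s) ('X - x%:P).
  rewrite -(eqp_map phi) -map_poly_comp (eq_map_poly phiA).
  apply: eqp_trans Qs _; rewrite rmorph_prod /= -{1}gsE !big_map.
  apply: eqpW; apply: eq_bigr => x _.
  by rewrite rmorphB /= map_polyX map_polyC.
(* The class w of X is a linear combination of the roots, hence so generated, and every element of L
   is a polynomial in w. *)
have genL : (<<1 & map g s>> = {:L0})%VS.
  apply/eqP; rewrite eqEsubv subvf /=; apply/subvP => x _.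
  pose w : L0 := subfx_root iota z m.
  have wz : phi w = z by apply: subfx_inj_root.
  have ws : w \in <<1 & map g s>>%VS.
    have -> : w = \sum_(i < size s) (c i) *: (map g s)`_i.
      apply: (fmorph_inj phi); rewrite wz zE rmorph_sum; apply: eq_bigr => i _.
      rewrite -mulr_algl rmorphM phiA; congr (_ * _).
      by rewrite (nth_map 0)// gP// mem_nth.
    apply: memv_suml => i _; apply: memvZ; apply: seqv_sub_adjoin.
    by rewrite mem_nth// size_map.
  have [r xE] := subfxEroot mz m0 x; rewrite xE.
  apply: rpred_horner => //; apply: (@polyOverSv _ _ 1%VS); first exact: subv_adjoin_seq.
  exact: alg_polyOver.
have splitQ : splittingFieldFor 1 (Q ^ in_alg L0) {:L0}%VS by exists (map g s).
have Q1 : Q ^ in_alg L0 \is a polyOver 1%VS by exact: alg_polyOver.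
have ax : splitting_field_axiom L0 by exists (Q ^ in_alg L0).
pose L : splittingFieldType F := HB.pack L0 (FieldExt_isSplittingField.Build F L0 ax).
exists L, phi; split => //.
  move=> r x rqs rx; apply: phi_root; rewrite QsE rootQ; apply/hasP.
  by exists r.
apply/and3P; split; first exact: subvf.
  have := genL; rewrite -/L => <-; apply: separable_Fadjoin_seq; apply/allP => _ /mapP[x xs ->].
  have [r sepr rx] := sep_s x xs; apply/separable_elementP.
  exists (r ^ in_alg L); split; first exact: alg_polyOver.
    rewrite -(fmorph_root phi) -map_poly_comp (eq_map_poly phiA).
    by rewrite gP.
  by rewrite separable_map.
by apply/splitting_normalField; [exact: subvf|exists (Q ^ in_alg L0)].
Qed.

End GaloisClosure.

(** * Subfields given as sets, as field types *)

Section SubfieldType.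
Variables (F : fieldType) (K : set F) (hK : is_subfield K).

(** The closure proof is an argument of the predicate so that the algebraic structure can be
    attached to it as an instance. *)
Definition subfield_pred of is_subfield K : {pred F} := [in K].

HB.instance Definition _ := GRing.isDivringClosed.Build F (subfield_pred hK) hK.

Record subfield_type :=
  Subfield { subfield_val : F ; _ : subfield_val \in subfield_pred hK }.

HB.instance Definition _ := [isSub for subfield_val].
HB.instance Definition _ := [Choice of subfield_type by <:].
HB.instance Definition _ := [SubChoice_isSubIntegralDomain of subfield_type by <:].
HB.instance Definition _ := [SubIntegralDomain_isSubField of subfield_type by <:].

Lemma subfield_inE x : (x \in subfield_pred hK) = (x \in K). Proof. by []. Qed.

Lemma subfield_valP (a : subfield_type) : K (val a).
Proof. by apply: set_mem; exact: valP. Qed.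

Lemma subfield_lift x : K x -> exists a : subfield_type, val a = x.
Proof. by move=> /mem_set Kx; exists (Subfield (Kx : x \in subfield_pred hK)). Qed.

Lemma subfield_polyOverP (f : {poly F}) :
  f \is a polyOver [in K] <-> forall i, K f`_i.
Proof.
rewrite (_ : (f \is a _) = (f \is a polyOver (subfield_pred hK)))//.
by split=> [/polyOverP H i|H]; [exact/set_mem/H|apply/polyOverP => i; exact/mem_set/H].
Qed.

Lemma subfield_lift_poly (f : {poly F}) : f \is a polyOver [in K] ->
  exists g : {poly subfield_type}, map_poly val g = f.
Proof.
move=> /subfield_polyOverP fK; exists (\poly_(i < size f) insubd 0 f`_i).
apply/polyP => i; rewrite coef_map coef_poly; case: ltnP => sf.
  by rewrite /= val_insubd subfield_inE mem_set.
by rewrite nth_default.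
Qed.

Lemma subfield0 : K 0. Proof. exact/set_mem/(rpred0 (subfield_pred hK)). Qed.
Lemma subfield1 : K 1. Proof. exact/set_mem/(rpred1 (subfield_pred hK)). Qed.
Lemma subfieldD x y : K x -> K y -> K (x + y).
Proof. by move=> /mem_set Kx /mem_set Ky; apply/set_mem/(rpredD (Kx : x \in subfield_pred hK)). Qed.
Lemma subfieldN x : K x -> K (- x).
Proof.
move=> /mem_set Kx; have := Kx : x \in subfield_pred hK.
by rewrite -rpredN => /set_mem.
Qed.
Lemma subfieldB x y : K x -> K y -> K (x - y).
Proof. by move=> Kx Ky; apply: subfieldD => //; exact: subfieldN. Qed.
Lemma subfieldM x y : K x -> K y -> K (x * y).
Proof. by move=> /mem_set Kx /mem_set Ky; apply/set_mem/(rpredM (Kx : x \in subfield_pred hK)). Qed.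
Lemma subfieldV x : K x -> K x^-1.
Proof.
move=> /mem_set Kx; have := Kx : x \in subfield_pred hK.
by rewrite -rpredV => /set_mem.
Qed.
Lemma subfieldX x n : K x -> K (x ^+ n).
Proof. by move=> Kx; elim: n => [|n IH]; [exact: subfield1|rewrite exprS; exact: subfieldM]. Qed.
Lemma subfield_sum I (r : seq I) (P : pred I) (G : I -> F) :
  (forall i, P i -> K (G i)) -> K (\sum_(i <- r | P i) G i).
Proof. by move=> H; elim/big_ind: _ => //; [exact: subfield0|exact: subfieldD]. Qed.

Lemma has_degree_uniq x m n : has_degree K x m -> has_degree K x n -> m = n.
Proof.
move=> [f [fm fK fx fmin] fs] [g [gm gK gx gmin] gs].
have fg := fmin g gK (monic_neq0 gm) gx.
have gf := gmin f fK (monic_neq0 fm) fx.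
by apply/eqP; rewrite -eqSS -fs -gs eqn_leq fg gf.
Qed.

Lemma has_degree1 x : has_degree K x 1 -> K x.
Proof.
move=> [f [fm /subfield_polyOverP fK fx _] fs].
have f1 : f`_1 = 1 by move: fm; rewrite monicE lead_coefE fs => /eqP.
move: fx; rewrite /root horner_coef fs !big_ord_recl big_ord0 /= f1.
rewrite expr0 expr1 mulr1 mul1r addr0 addrC addr_eq0 => /eqP ->.
exact: subfieldN.
Qed.

Lemma has_degree1_mem x : K x -> has_degree K x 1.
Proof.
move=> Kx; exists ('X - x%:P); last by rewrite size_XsubC.
split; rewrite ?monicXsubC ?root_XsubC//.
  apply/subfield_polyOverP => i; rewrite coefB coefX coefC.
  apply: subfieldB; first by case: eqP => _ /=; [exact: subfield1|exact: subfield0].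
  by case: eqP => _ //; exact: subfield0.
by move=> g _ g0 gx; rewrite size_XsubC; exact: root_size_gt1 gx.
Qed.

Lemma sub_adjoin A : K `<=` adjoin K A.
Proof. by move=> x Kx M [_]; apply; left. Qed.

Lemma mem_adjoin A x : A x -> adjoin K A x.
Proof. by move=> Ax M [_]; apply; right. Qed.

Lemma adjoin_subfield A : is_subfield (adjoin K A).
Proof.
split=> [|x y /set_mem Ax /set_mem Ay|x y /set_mem Ax /set_mem Ay].
- by apply: mem_set; apply: sub_adjoin; exact: subfield1.
- apply: mem_set => M [sM KAM]; have [_ MB _] := sM; apply: set_mem.
  by apply: MB; apply: mem_set; [exact: Ax|exact: Ay].
- apply: mem_set => M [sM KAM]; have [_ _ MV] := sM; apply: set_mem.
  by apply: MV; apply: mem_set; [exact: Ax|exact: Ay].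
Qed.

End SubfieldType.

(** * Galois correspondence and degrees transported along the embedding *)

Section Galois.
Variables (E : fieldType) (K : set E) (hK : is_subfield K).
Variables (L : splittingFieldType (subfield_type hK)) (phi : {rmorphism L -> E}).
Hypothesis phiA : forall a : subfield_type hK, phi a%:A = val a.
Hypothesis galL : galois 1 {:L}.
Local Notation G := (gal_of {:L}).
Implicit Types (x y z : L) (s t : G).

Lemma phi_base x : x \in 1%VS -> K (phi x).
Proof. by move=> /vlineP[a ->]; rewrite phiA; exact: subfield_valP. Qed.

Lemma base_lift a : K a -> exists2 x : L, x \in 1%VS & phi x = a.
Proof.
move=> /(subfield_lift hK)[b <-]; exists b%:A; last exact: phiA.
by apply/vlineP; exists b.
Qed.

Lemma gal_base s x : x \in 1%VS -> s x = x.
Proof.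
move=> x1; apply: (@fixed_gal _ _ 1%AS {:L}%AS) => //; first exact: sub1v.
by rewrite gal_kHom ?sub1v// k1HomE ahomWin.
Qed.

Lemma gal_fixed_base x : (forall s, s x = x) -> x \in 1%VS.
Proof.
move=> fx; have /galois_fixedField <- := galL.
by apply/fixedFieldP; [exact: memvf|move=> s _; exact: fx].
Qed.

(** Galois correspondence for L over K(y); this is how Krasner-type arguments conclude. *)
Lemma gal_adjoin x y : (forall s, s y = y -> s x = x) -> x \in <<1; y>>%VS.
Proof.
move=> fx; have galy : galois <<1; y>> {:L}.
  by apply: galoisS galL; rewrite subv_adjoin subvf.
have /galois_fixedField <- := galy.
apply/fixedFieldP => [|s /(fixed_gal (subvf _)) sP]; first exact: memvf.
by apply: fx; apply: sP; exact: memv_adjoin.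
Qed.

Lemma gal_fix_adjoin s x y : s y = y -> x \in <<1; y>>%VS -> s x = x.
Proof.
move=> sy /Fadjoin_polyP[f /polyOverP f1 ->].
rewrite -horner_map /= sy; congr (_.[_]).
by apply/polyP => i; rewrite coef_map /= gal_base.
Qed.

Lemma galMx s t x : (s * t)%g x = t (s x).
Proof. by rewrite galM ?memvf. Qed.

(** Polynomials over K lift along [phi] to the base field of L, so minimality can be tested
    there. *)
Lemma has_degree_phi x : has_degree K (phi x) (adjoin_degree 1 x).
Proof.
exists (map_poly phi (minPoly 1 x)); last by rewrite size_map_poly size_minPoly.
split.
- by rewrite map_monic monic_minPoly.
- apply/(subfield_polyOverP hK) => i; rewrite coef_map; apply/phi_base.
  exact: (polyOverP (minPolyOver 1%AS x)).
- by rewrite fmorph_root root_minPoly.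
- move=> g /(subfield_lift_poly hK)[h <-]; rewrite map_poly_eq0 => h0.
  have hE : map_poly val h = map_poly phi (map_poly (in_alg L) h).
    by rewrite -map_poly_comp; apply: eq_map_poly => a; rewrite /= phiA.
  rewrite hE !size_map_poly fmorph_root => hx.
  have := minPoly_dvdp (alg_polyOver 1%AS h) hx.
  by move=> /dvdp_leq; rewrite size_map_poly; apply; rewrite map_poly_eq0.
Qed.

Lemma phi_adjoin x y : x \in <<1; y>>%VS -> adjoin K [set phi y] (phi x).
Proof.
move=> /Fadjoin_polyP[f /polyOverP f1 ->]; rewrite -horner_map horner_coef.
have hN := adjoin_subfield hK [set phi y].
apply: (subfield_sum hN) => i _; apply: (subfieldM hN).
  by rewrite coef_map; apply: sub_adjoin; exact: phi_base.
by apply: (subfieldX hN); exact: mem_adjoin.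
Qed.

Lemma adjoin_fix (A : set E) s :
    (forall a, A a -> exists2 x, phi x = a & s x = x) ->
  forall x, adjoin K A (phi x) -> s x = x.
Proof.
move=> AP; pose M := [set a | exists2 x, phi x = a & s x = x].
(* The images of the elements fixed by s form a subfield; containing K and A, it contains K(A). *)
have sM : is_subfield M.
  split.
  - by apply: mem_set; exists 1; rewrite ?rmorph1.
  - move=> _ _ /set_mem[x <- sx] /set_mem[y <- sy]; apply: mem_set.
    by exists (x - y); rewrite ?rmorphB //= sx sy.
  - move=> _ _ /set_mem[x <- sx] /set_mem[y <- sy]; apply: mem_set.
    by exists (x / y); rewrite ?fmorph_div//= sx sy.
have KAM : K `|` A `<=` M.
  by move=> a [/base_lift[y y1 <-]|/AP//]; exists y => //; exact: gal_base.
by move=> x /(_ M (conj sM KAM)) [y /fmorph_inj->].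
Qed.

Lemma deg_le x y : x \in <<1; y>>%VS -> (adjoin_degree 1 x <= adjoin_degree 1 y)%N.
Proof.
move=> xy; have dE z : \dim <<1; z>> = adjoin_degree 1 z.
  by rewrite dim_Fadjoin dimv1 muln1.
rewrite -!dE; apply: dimvS.
by apply/FadjoinP; split => //; exact: sub1v.
Qed.

Lemma deg_lt s x y : x \in <<1; y>>%VS -> s x = x -> s y != y ->
  (adjoin_degree 1 x < adjoin_degree 1 y)%N.
Proof.
move=> xy sx sy; rewrite ltn_neqAle deg_le// andbT; apply: contraNneq sy => dE.
have : <<1; x>>%VS == <<1; y>>%VS.
  rewrite eqEdim !dim_Fadjoin dE leqnn andbT.
  by apply/FadjoinP; split => //; exact: sub1v.
move=> /eqP xyE; apply/eqP; apply: (gal_fix_adjoin sx).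
by rewrite xyE memv_adjoin.
Qed.

End Galois.

(** * Products and polynomials with integral coefficients *)

Section Integral.
Variable k : fieldType.

Lemma hprod_lead I (r : seq I) (P : pred I) (F : I -> hahn k) (q : I -> rat) :
    (forall i, P i -> vge (q i) (F i)) ->
  (\prod_(i <- r | P i) F i) (\sum_(i <- r | P i) q i) =
    \prod_(i <- r | P i) F i (q i).
Proof.
move=> H; pose Q (x : hahn k) (w : rat) (c : k) := vge w x /\ x w = c.
suff [] : Q (\prod_(i <- r | P i) F i) (\sum_(i <- r | P i) q i)
            (\prod_(i <- r | P i) F i (q i)) by [].
apply: (big_rec3 Q) => [|i c w x Pi [vx <-]]; first by split; [exact: vge1|exact: hcoef10].
by split; [apply: vgeM => //; exact: H|apply: hcoefM_lead => //; exact: H].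
Qed.

Lemma vge0_horner (f : {poly hahn k}) x :
  (forall i, vge 0 f`_i) -> vge 0 x -> vge 0 f.[x].
Proof.
move=> vf vx; rewrite horner_coef; apply: vge_sum => i _.
rewrite -[0]addr0; apply: vgeM => //.
by rewrite -(mul0rn _ i); exact: vgeX.
Qed.

Lemma vge0_prod_XsubC I (r : seq I) (P : pred I) (F : I -> hahn k) :
    (forall i, P i -> vge 0 (F i)) ->
  forall j, vge 0 (\prod_(i <- r | P i) ('X - (F i)%:P))`_j.
Proof.
move=> H; elim/big_rec: _ => [|i f Pi IH] j.
  by rewrite coef1; case: eqP => _; [exact: vge1|exact: vge0].
rewrite mulrBl coefB coefXM coefCM; apply: vgeB; first by case: eqP.
by rewrite -[0]addr0; apply: vgeM => //; exact: H.
Qed.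

End Integral.

(** * Invariance of the valuation under the Galois group, from Hensel's lemma *)

Section Henselian.
Variables (k : fieldType) (K : set (hahn k)) (hK : is_subfield K).
Hypothesis hhens : henselian K.
Variables (L : splittingFieldType (subfield_type hK)) (phi : {rmorphism L -> hahn k}).
Hypothesis phiA : forall a : subfield_type hK, phi a%:A = val a.
Hypothesis galL : galois 1 {:L}.
Local Notation G := (gal_of {:L}).
Implicit Types (x : L) (s t : G) (B : {set G}).

(* Otherwise the conjugates of minimal valuation form a proper subset A of G,
   and z A below would be a simple root modulo the maximal ideal of a polynomial
   over K, hence would lie in K: but the conjugates z (A :* t) of z A with
   A :* t <> A have positive valuation, while z A does not. *)
Lemma gal_vge s q x : vge q (phi x) -> vge q (phi (s x)).
Proof.
have [->|x0] := eqVneq x 0; first by rewrite !rmorph0.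
have /choice[l lP] t : exists w, phi (t x) w != 0 /\ vge w (phi (t x)).
  by have [|w] := @vge_lead _ (phi (t x)); [rewrite !fmorph_eq0|exists w].
case: (arg_minP l (erefl : predT (1%g : G))) => s0 _ s0_min.
set mu := l s0; pose A := [set t | l t == mu]%SET; pose n := #|A|.
have [AT|AT] := eqVneq A [set: G]%SET.
  have lmu t : l t = mu.
    apply/eqP; have : t \in A by rewrite AT finset.in_setT.
    by rewrite inE.
  move=> vx; have qmu : q <= mu.
    by rewrite -(lmu 1%g); apply: vge_neq0 vx; have [+ _] := lP 1%g; rewrite gal_id.
  by apply: vge_le qmu _; have [_] := lP s; rewrite lmu.
exfalso.
pose P B := \prod_(t in B) t x.
have PE B : phi (P B) = \prod_(t in B) phi (t x) by rewrite rmorph_prod.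
have vP B : vge (\sum_(t in B) l t) (phi (P B)).
  by rewrite PE; apply: vge_prod => t _; have [] := lP t.
have PA : phi (P A) (mu *+ n) != 0.
  have -> : mu *+ n = \sum_(t in A) l t.
    by rewrite -sumr_const; apply: eq_bigr => t; rewrite inE => /eqP.
  rewrite PE hprod_lead; last by move=> t _; have [] := lP t.
  by apply/prodf_neq0 => t _; have [] := lP t.
have vPA : vge (mu *+ n) (phi (P A)).
  have -> : mu *+ n = \sum_(t in A) l t; last exact: vP.
  by rewrite -sumr_const; apply: eq_bigr => t; rewrite inE => /eqP.
have vPB B : #|B| = n -> B != A -> vgt (mu *+ n) (phi (P B)).
  move=> Bn BA; apply: vge_lt (vP B).
  have [t tB tA] : exists2 t, t \in B & t \notin A.
    by apply/subsetPn; apply: contra BA => BA; rewrite eqEcard BA Bn leqnn.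
  rewrite -Bn -sumr_const (bigD1 t)//= [X in _ < X](bigD1 t)//=.
  apply: ltr_leD; last by apply: ler_sum => u _; exact: s0_min.
  by rewrite lt_neqAle s0_min// andbT eq_sym; move: tA; rewrite inE.
(* The n-th elementary symmetric function of the family of conjugates is Galois invariant. Its
   dominant term is [P A], since A is the only n-element set of minimal total valuation. *)
pose e := \sum_(B : {set G} | #|B| == n) P B.
have eE : e = P A + \sum_(B : {set G} | (#|B| == n) && (B != A)) P B.
  by rewrite /e (bigD1 A)//= eqxx.
have v_rest : vgt (mu *+ n) (phi (\sum_(B : {set G} | (#|B| == n) && (B != A)) P B)).
  by rewrite rmorph_sum; apply: vgt_sum => B /andP[/eqP Bn BA]; exact: vPB.
have ve : vge (mu *+ n) (phi e).
  by rewrite eE rmorphD; apply: vgeD => //; exact: vgtW.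
have ce : phi e (mu *+ n) != 0.
  by rewrite eE rmorphD hcoefD; case: v_rest => _ ->; rewrite addr0.
have e0 : e != 0 by apply: contraNneq ce => ->; rewrite rmorph0.
have [veV _] := vgeV ce ve.
pose z B := P B / e.
have vz B : #|B| = n -> B != A -> vgt 0 (phi (z B)).
  by move=> Bn BA; rewrite fmorph_div -(subrr (mu *+ n)); apply: vgtMl => //; exact: vPB.
have vzA : vgt 0 (phi (z A) - 1).
  have -> : phi (z A) - 1 = - phi (\sum_(B : {set G} | (#|B| == n) && (B != A)) P B) / phi e.
    rewrite -(rmorph1 phi) -rmorphB -rmorphN -fmorph_div; congr (phi _).
    apply: (mulIf e0); rewrite mulrBl mul1r !divfK// eE; ring.
  by rewrite -(subrr (mu *+ n)); apply: vgtMl => //; exact: vgtN.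
have vge_zA : vge 0 (phi (z A)).
  by rewrite -(subrK 1 (phi (z A))); apply: vgeD; [exact: vgtW|exact: vge1].
have vz0 B : #|B| == n -> vge 0 (phi (z B)).
  by move=> /eqP Bn; have [->//|BA] := eqVneq B A; apply: vgtW; exact: vz.
have cardM B t : #|(B :* t)%g| = #|B| by rewrite card_rcoset.
have tP B t : t (P B) = P (B :* t)%g.
  rewrite rmorph_prod /= /P -rcosetE /rcoset big_imset /=; last by move=> u v _ _; exact: mulIg.
  by apply: eq_bigr => u _; rewrite galMx.
have rc_inj t : injective (fun B => B :* t)%g.
  by move=> B C BC; rewrite -(rcosetK t B) -(rcosetK t C) BC.
have te t : t e = e.
  rewrite rmorph_sum /= [RHS](reindex_inj (rc_inj t)) /=.
  by apply: eq_big => [B|B _]; rewrite ?cardM ?tP.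
have tz B t : t (z B) = z (B :* t)%g by rewrite fmorph_div /= tP te.
(* The group permutes the [z B], so Q has coefficients in the base field. Modulo the maximal ideal
   one root is 1 and all others are 0. *)
pose Q := \prod_(B : {set G} | #|B| == n) ('X - (z B)%:P).
pose f := map_poly phi Q.
have fE : f = \prod_(B : {set G} | #|B| == n) ('X - (phi (z B))%:P).
  by rewrite /f rmorph_prod; apply: eq_bigr => B _; rewrite /= rmorphB /= map_polyX map_polyC.
have tQ t : map_poly t Q = Q.
  rewrite rmorph_prod /= [RHS](reindex_inj (rc_inj t)) /=.
  apply: eq_big => [B|B _]; rewrite ?cardM//.
  by rewrite rmorphB /= map_polyX map_polyC /= tz.
have Q1 i : Q`_i \in 1%VS.
  by apply: (gal_fixed_base galL) => t; rewrite -[in RHS](tQ t) coef_map.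
have fK : f \is a polyOver [in K `&` valring k].
  apply/(all_nthP 0) => i _; apply: mem_set; split.
    by rewrite coef_map; apply: (phi_base phiA); exact: Q1.
  by apply/hval_ge; rewrite fE; apply: vge0_prod_XsubC.
have f_monic : f \is monic by rewrite fE monic_prod_XsubC.
have K1 : (K `&` valring k) 1.
  by split; [exact: subfield1|apply/hval_ge; exact: vge1].
pose g := \prod_(B : {set G} | (#|B| == n) && (B != A)) ('X - (phi (z B))%:P).
have fg : f = ('X - (phi (z A))%:P) * g by rewrite fE (bigD1 A)//= eqxx.
have vg i : vge 0 g`_i by apply: vge0_prod_XsubC => B /andP[/vz0].
have vg1 : vge 0 g.[1] by apply: vge0_horner => //; exact: vge1.
have cg1 : g.[1] 0 = 1.
  rewrite /g horner_prod.
  have -> : 0 = \sum_(B : {set G} | (#|B| == n) && (B != A)) (0 : rat) by rewrite big1.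
  rewrite hprod_lead => [|B /andP[/vz0 Bn BA]]; last first.
    by rewrite hornerXsubC; apply: vgeB => //; exact: vge1.
  rewrite big1// => B /andP[/eqP Bn BA]; rewrite hornerXsubC hcoefB hcoef10.
  by have [_ ->] := vz B Bn BA; rewrite subr0.
have vA1 : vgt 0 (1 - phi (z A)) by rewrite -opprB; exact: vgtN.
have f1 : (0 < hval f.[1])%E.
  apply/hval_gt; rewrite fg hornerM hornerXsubC -(addr0 0).
  exact: vgtMl.
have f'1 : hval f^`().[1] = 0%E.
  apply/hval_eq0; rewrite fg derivM derivXsubC mul1r hornerD hornerM hornerXsubC.
  have vr : vgt 0 ((1 - phi (z A)) * g^`().[1]).
    rewrite -(addr0 0); apply: vgtMl => //; apply: vge0_horner; last exact: vge1.
    by move=> i; rewrite coef_deriv; exact: vgeMn.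
  split; first by apply: vgeD => //; exact: vgtW.
  by rewrite hcoefD cg1; case: vr => _ ->; rewrite addr0 oner_neq0.
(* The lift b of the simple residue root 1 can only be [z A], which is therefore invariant. *)
have [b [Kb _] [fb /hval_gt vb]] := hhens f_monic fK K1 f1 f'1.
have [B /eqP Bn bE] : exists2 B : {set G}, #|B| == n & b = phi (z B).
  move: fb; rewrite fE /root horner_prod prodf_seq_eq0 => /hasP[B _ /andP[Bn]].
  by rewrite hornerXsubC subr_eq0 => /eqP ->; exists B.
have notpos (c : hahn k) : vgt 0 (c - 1) -> vgt 0 c -> False.
  move=> c1 c0; have := vgtB c0 c1; rewrite subKr => -[_].
  by rewrite hcoef10 => /eqP; rewrite oner_eq0.
have BA : B = A.
  apply/eqP; apply: contraT => BA; exfalso; apply: (notpos _ vb).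
  by rewrite bE; exact: vz.
have zA1 : z A \in 1%VS.
  by have [y y1 yE] := base_lift phiA Kb; rewrite -BA -(fmorph_inj phi (etrans yE bE)).
have At t : (A :* t)%g = A.
  apply/eqP; apply: contraT => tA; exfalso; apply: (notpos _ vzA).
  by rewrite -(gal_base t zA1) tz; apply: vz; rewrite ?cardM.
(* A contains [s0] and is stable under right translations, so it is the whole group. *)
move: AT; rewrite -finset.subTset => /negP; apply; apply/fintype.subsetP => t _.
rewrite -(At (s0^-1 * t)%g); apply/rcosetP; exists s0; last by rewrite mulKVg.
by rewrite inE.
Qed.

Lemma gal_vgt s q x : vgt q (phi x) -> vgt q (phi (s x)).
Proof. by move=> /vgtE[r qr vx]; apply/vgtE; exists r => //; exact: gal_vge. Qed.

Lemma gal_vge_sub s q x y : phi y \in K -> vge q (phi x - phi y) -> vge q (phi (s x) - phi x).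
Proof.
move=> /set_mem Ky; have [c c1 /fmorph_inj cE] := base_lift phiA Ky.
rewrite -rmorphB => vxy; have -> : phi (s x) - phi x = phi (s (x - y)) - phi (x - y).
  by rewrite rmorphB /= -cE (gal_base s c1) !rmorphB /=; ring.
by apply: vgeB => //; exact: gal_vge.
Qed.

End Henselian.

(** * The constants of the Hahn field *)

Section Const.
Variable k : fieldType.

Definition hconst (c : k) : hahn k := hmono c 0.

Lemma hconst_is_zmod_morphism : zmod_morphism hconst.
Proof.
move=> c d; apply/hahnP => q; rewrite hcoefB /= /hmono_fun.
by case: eqP; rewrite ?subr0.
Qed.

Lemma hconst_is_monoid_morphism : monoid_morphism hconst.
Proof. by split=> [//|c d]; rewrite /hconst hmonoM addr0. Qed.

HB.instance Definition _ :=
  GRing.isZmodMorphism.Build k (hahn k) hconst hconst_is_zmod_morphism.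
HB.instance Definition _ :=
  GRing.isMonoidMorphism.Build k (hahn k) hconst hconst_is_monoid_morphism.

Lemma hcoef_const c : hconst c 0 = c. Proof. exact: hcoef_hmono. Qed.

Lemma vge_const c : vge 0 (hconst c). Proof. exact: vge_hmono. Qed.

End Const.

(** * Artin-Schreier series: expansions, bounds and coefficients *)

Section Series.
Variables (k : closedFieldType) (p : nat).
Hypothesis pk : p \in [pchar k].
Implicit Types (x y g : hahn k) (q : rat).

Let p_prime : prime p. Proof. exact: pcharf_prime pk. Qed.
Let p_gt0 : (0 < p)%N. Proof. exact: prime_gt0. Qed.
Let p_gt1 : (1 < p)%N. Proof. exact: prime_gt1. Qed.
Let pQ_gt0 : 0 < p%:R :> rat. Proof. by rewrite ltr0n. Qed.
Let pX_gt0 n : 0 < (p ^ n)%:R :> rat. Proof. by rewrite ltr0n expn_gt0 p_gt0. Qed.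
Let pH : p \in [pchar hahn k]. Proof. exact: pchar_hahn. Qed.

Lemma pexpB x y : (x - y) ^+ p = x ^+ p - y ^+ p.
Proof. by rewrite -!(pFrobenius_autE pH) rmorphB. Qed.

Lemma pexpDn n x y : (x + y) ^+ (p ^ n) = x ^+ (p ^ n) + y ^+ (p ^ n).
Proof.
elim: n => [|n IH]; first by rewrite expn0 !expr1.
by rewrite expnSr !exprM IH (hpexpD pk).
Qed.

Lemma hcoef_pexp_mul x q : (x ^+ p) (q * p%:R) = x q ^+ p.
Proof. by rewrite (hcoef_pexp pk) mulfK// gt_eqF. Qed.

(* [x ^+ p] has strictly smaller valuation than [x] when the latter is
   negative, so it must be cancelled by [g]. *)
Lemma artin_schreier_vge x g q :
  x ^+ p - x = g -> q <= 0 -> vge q g -> vge (q / p%:R) x.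
Proof.
move=> xg q0 vg; have [->//|/vge_lead[m xm vx]] := eqVneq x 0.
apply: (vge_le _ vx); rewrite leNgt; apply/negP => mq.
have m0 : m < 0 by apply: lt_le_trans mq _; rewrite pmulr_lle0// invr_gt0.
have pm : m * p%:R < m by rewrite gtr_nMr// ltr1n.
have : (x ^+ p) (m * p%:R) != 0 by rewrite hcoef_pexp_mul expf_neq0.
rewrite (_ : x ^+ p = g + x); last by rewrite -xg subrK.
rewrite hcoefD vg; last by rewrite -ltr_pdivlMr.
by rewrite vx// addr0 eqxx.
Qed.

(** The difference u of x and its constant coefficient has positive valuation and satisfies u^p = u,
    whereas p-th powers multiply valuations by p; so u = 0. This makes the Galois translations
    constants of k. *)
Lemma artin_schreier_const x c : x ^+ p - x = hconst c ->
  x = hconst (x 0) /\ x 0 ^+ p - x 0 = c.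
Proof.
move=> xc; have vx : vge 0 x.
  by have := artin_schreier_vge xc (lexx 0) (vge_const c); rewrite mul0r.
have c0 : x 0 ^+ p - x 0 = c.
  by rewrite -hcoef_pexp_mul mul0r -hcoefB xc hcoef_const.
split=> //; apply/eqP; rewrite -subr_eq0; apply/eqP.
set u := x - _; have uu : u ^+ p = u.
  apply/eqP; rewrite -subr_eq0 /u pexpB; apply/eqP.
  transitivity (x ^+ p - x - (hconst (x 0) ^+ p - hconst (x 0))); first by ring.
  by rewrite xc -rmorphXn -rmorphB c0 subrr.
have [->//|/vge_lead[m um vu]] := eqVneq u 0.
have m0 : 0 < m.
  rewrite lt_neqAle (vge_neq0 um) ?andbT; last by apply: vgeB => //; exact: vge_const.
  by apply: contraNneq um => <-; rewrite hcoefB hcoef_const subrr.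
have : (u ^+ p) m != 0 by rewrite uu.
rewrite (hcoef_pexp pk) vu ?expr0n ?gtn_eqF ?eqxx//.
by rewrite ltr_pdivrMr// ltr_pMr// ltr1n.
Qed.

Definition proot n x := hroot (p ^ n) x.

Lemma prootK n x : proot n x ^+ (p ^ n) = x. Proof. exact: hrootP. Qed.

Lemma proot_eq n x y : y ^+ (p ^ n) = x -> proot n x = y.
Proof. by move=> yx; apply: (hexpp_inj pk (n := n)); rewrite prootK. Qed.

Lemma proot0 x : proot 0 x = x. Proof. by apply: proot_eq; rewrite expn0 expr1. Qed.

Lemma proot_vge n q x : vge q x -> vge (q / (p ^ n)%:R) (proot n x).
Proof.
move=> vx r rq; have := hcoef_pexpn pk n (proot n x) (r * (p ^ n)%:R).
rewrite prootK mulfK ?gt_eqF// vx; last by rewrite -ltr_pdivlMr.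
by move=> /esym/eqP; rewrite expf_eq0 => /andP[_ /eqP].
Qed.

(** Taking p^(j+1)-th roots in x^p = x + g gives x^(1/p^j) = x^(1/p^(j+1)) + g^(1/p^(j+1)), and the
    sum over j < n telescopes. *)
Lemma proot_artin_schreier x g n : x ^+ p - x = g ->
  x = proot n x + \sum_(j < n) proot j.+1 g.
Proof.
move=> xg; elim: n => [|n IH]; first by rewrite big_ord0 addr0 proot0.
have E : proot n x = proot n.+1 x + proot n.+1 g.
  apply: (hexpp_inj pk (n := n.+1)) => /=.
  by rewrite pexpDn !prootK expnSr exprM prootK -xg addrC subrK.
by rewrite {1}IH E big_ord_recr /=; ring.
Qed.

Definition ymono n : hahn k := hmono 1 (- (p ^ n)%:R^-1).

Lemma proot_ymono n : proot n (hmono 1 (-1)) = ymono n.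
Proof.
apply: proot_eq; rewrite /ymono hmono_pow expr1n mulNrn; congr (hmono _ (- _)).
by rewrite -[LHS]mulr_natr mulVf// gt_eqF.
Qed.

Local Notation alpha := (alpha k p).
Local Notation theta := (theta k p).
Local Notation eta := (eta k p).

Definition alpha_part n : hahn k := \sum_(j < n) ymono j.+1.

Definition theta_part n : hahn k := \sum_(j < n) alpha_part j.+1.

Lemma alpha_expand n : alpha = proot n alpha + alpha_part n.
Proof.
rewrite {1}(proot_artin_schreier n (alpha_eq pk)); congr (_ + _).
by apply: eq_bigr => j _; exact: proot_ymono.
Qed.

Lemma proot_alpha n : proot n alpha = alpha - alpha_part n.
Proof. by rewrite {2}(alpha_expand n) addrK. Qed.

Lemma theta_expand n : theta = proot n theta + alpha *+ n - theta_part n.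
Proof.
rewrite {1}(proot_artin_schreier n (theta_eq pk)) -addrA; congr (_ + _).
rewrite (eq_bigr (fun j : 'I_n => alpha - alpha_part j.+1)); last first.
  by move=> j _; exact: proot_alpha.
by rewrite sumrB sumr_const card_ord.
Qed.

Lemma prootM n x y : proot n (x * y) = proot n x * proot n y.
Proof. by apply: proot_eq; rewrite exprMn !prootK. Qed.

Lemma eta_expand n : eta = proot n eta + alpha ^+ 2 *+ n
  + (\sum_(j < n) alpha_part j.+1 ^+ 2 - alpha * theta_part n *+ 2).
Proof.
rewrite {1}(proot_artin_schreier n (eta_eq pk)) -addrA; congr (_ + _).
rewrite (eq_bigr (fun j : 'I_n => alpha ^+ 2 +
  (alpha_part j.+1 ^+ 2 - alpha * alpha_part j.+1 *+ 2))); last first.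
  by move=> j _; rewrite expr2 prootM proot_alpha; ring.
rewrite big_split sumr_const card_ord /= sumrB; congr (_ + (_ - _)).
by rewrite mulr_sumr sumrMnl.
Qed.

Lemma natr_dvd0 n : (p %| n)%N -> n%:R = 0 :> hahn k.
Proof. by move=> pn; apply/eqP; rewrite -(dvdn_pcharf pH). Qed.

(** For p | n the multiple n alpha vanishes, so [theta] is a finite sum of monomials up to the tail
    [proot n theta]. *)
Lemma theta_expand_dvd n : (p %| n)%N -> theta = proot n theta - theta_part n.
Proof.
by move=> pn; rewrite {1}(theta_expand n) -mulr_natr natr_dvd0// mulr0 addr0.
Qed.

(** The quadratic term n alpha^2 vanishes as well: up to its tail, [eta] is affine in [alpha]. *)
Lemma eta_expand_dvd n : (p %| n)%N -> eta = proot n eta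
  + (\sum_(j < n) alpha_part j.+1 ^+ 2 - alpha * theta_part n *+ 2).
Proof.
by move=> pn; rewrite {1}(eta_expand n) -[_ *+ n]mulr_natr natr_dvd0// mulr0 addr0.
Qed.

Lemma vge_alpha : vge (- p%:R^-1) alpha.
Proof.
have := artin_schreier_vge (alpha_eq pk) _ (@vge_hmono k 1 (-1)).
by rewrite mulN1r; apply; rewrite oppr_le0.
Qed.

Lemma vge_theta : vge (- (p ^ 2)%:R^-1) theta.
Proof.
have := artin_schreier_vge (theta_eq pk) _ vge_alpha.
rewrite mulNr -invfM -natrM mulnn; apply.
by rewrite oppr_le0 invr_ge0 ler0n.
Qed.

(** A crude bound, sufficient to bound the tail [proot n eta] by -1/p^n. *)
Lemma vge_eta : vge (-1) eta.
Proof.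
have v2 : vge (- p%:R^-1 *+ 2) (alpha ^+ 2) by apply: vgeX; exact: vge_alpha.
have q0 : - p%:R^-1 *+ 2 <= 0 :> rat by rewrite mulrn_wle0// oppr_le0 invr_ge0 ler0n.
apply: vge_le (artin_schreier_vge (eta_eq pk) q0 v2).
rewrite ler_pdivlMr// mulN1r mulNrn lerN2.
have p2 : (2 : rat) <= p%:R by rewrite ler_nat.
rewrite -[_ *+ 2]mulr_natr mulrC ler_pdivrMr//; apply: (le_trans p2).
by rewrite ler_peMr// (le_trans _ p2).
Qed.

Lemma pth_power1 (c : k) : c ^+ p = 1 -> c = 1.
Proof.
rewrite -[RHS](expr1n _ p) -!(pFrobenius_autE pk); exact: fmorph_inj.
Qed.

Let inv_pS n : - (p ^ n)%:R^-1 = - (p ^ n.+1)%:R^-1 * p%:R :> rat.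
Proof. by rewrite expnSr natrM invfM mulNr divfK// gt_eqF. Qed.

Lemma alpha_coef n : alpha (- (p ^ n.+1)%:R^-1) = 1.
Proof.
have rec m : alpha (- (p ^ m.+1)%:R^-1) ^+ p =
    alpha (- (p ^ m)%:R^-1) + hmono 1 (-1) (- (p ^ m)%:R^-1).
  rewrite -hcoef_pexp_mul -inv_pS -(alpha_eq pk) hcoefB; ring.
elim: n => [|n IH]; apply: pth_power1; rewrite rec.
  rewrite expn0 invr1 hcoef_hmono vge_alpha ?add0r//.
  by rewrite ltrN2 invf_lt1// ltr1n.
rewrite IH /= /hmono_fun; case: eqP => [|_]; last by rewrite addr0.
move=> /oppr_inj/(congr1 GRing.inv); rewrite invrK invr1 => /eqP.
by rewrite pnatr_eq1 gtn_eqF// -[X in (X < _)%N](expn0 p) ltn_exp2l.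
Qed.

(** Comparing coefficients in theta^p = theta + alpha adds 1 at each step, as the corresponding
    coefficients of [alpha] are 1. *)
Lemma theta_coef n : theta (- (p ^ n.+1)%:R^-1) = n%:R.
Proof.
have rec m : theta (- (p ^ m.+1)%:R^-1) ^+ p =
    theta (- (p ^ m)%:R^-1) + alpha (- (p ^ m)%:R^-1).
  rewrite -hcoef_pexp_mul -inv_pS -(theta_eq pk) hcoefB; ring.
elim: n => [|n IH].
  rewrite vge_theta// ltrN2 ltf_pV2 ?posrE// ltr_nat ltn_exp2l//.
have := rec n.+1; rewrite IH alpha_coef natr1.
rewrite -[RHS](pFrobenius_aut_nat pk) -(pFrobenius_autE pk); exact: fmorph_inj.
Qed.

(** Here [theta_part n] is the tail minus [theta], and the tail has larger valuation than [theta],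
    whose leading term is y^(-1/p^2). *)
Lemma theta_part_vge n : (0 < n)%N -> (p %| n)%N ->
  vge (- (p ^ 2)%:R^-1) (theta_part n) /\ theta_part n (- (p ^ 2)%:R^-1) = -1.
Proof.
move=> n0 pn; have -> : theta_part n = proot n theta - theta.
  by rewrite {2}(theta_expand_dvd pn) opprD addrA subrr add0r opprK.
have lt : - (p ^ 2)%:R^-1 < - (p ^ 2)%:R^-1 / (p ^ n)%:R :> rat.
  rewrite mulNr ltrN2 ltr_pdivrMr// ltr_pMr ?invr_gt0// ltr1n.
  by rewrite -(expn0 p) ltn_exp2l.
have [v0 c0] := vge_lt lt (@proot_vge n _ _ vge_theta).
split; first by apply: vgeB => //; exact: vge_theta.
by rewrite hcoefB c0 theta_coef sub0r.
Qed.

End Series.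

Lemma algebraic_artin_schreier (F E : fieldType) (iota : {rmorphism F -> E}) p x :
  (1 < p)%N -> algebraicOver iota (x ^+ p - x) -> algebraicOver iota x.
Proof.
move=> p_gt1 [g g0 gx]; exists (g \Po ('X^p - 'X)).
  by rewrite comp_poly_eq0// size_polyDl ?size_polyN ?size_polyX size_polyXn ltnS // ltnW.
by rewrite /root map_comp_poly horner_comp rmorphB /= map_polyXn map_polyX !hornerE.
Qed.

(** * Consequences of the hypotheses on K *)

Section Base.
Variables (R : realType) (k : closedFieldType) (p : nat).
Hypotheses (pk : p \in [pchar k]).
Variables (K : set (hahn k)) (hK : is_subfield K).
Hypotheses (hkK : ratfuns k `<=` K) (hperf : perfect_subfield K).
Hypothesis hlim : no_finite_limits R K.

Local Notation alpha := (alpha k p).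
Local Notation theta := (theta k p).
Local Notation eta := (eta k p).

Let p_prime : prime p. Proof. exact: pcharf_prime pk. Qed.
Let p_gt0 : (0 < p)%N. Proof. exact: prime_gt0. Qed.
Let p_gt1 : (1 < p)%N. Proof. exact: prime_gt1. Qed.
Let pH : p \in [pchar hahn k]. Proof. exact: pchar_hahn. Qed.

Lemma base_const c : K (hconst c).
Proof. by apply: hkK => M [_]; apply; left; exists c. Qed.

Lemma base_y : K (hmono 1 1).
Proof. by apply: hkK => M [_]; apply; right. Qed.

Lemma base_yV : K (hmono 1 (-1)).
Proof.
have -> : hmono 1 (-1) = (hmono 1 1)^-1 :> hahn k.
  have E : hmono 1 (-1) * hmono 1 1 = 1 :> hahn k by rewrite hmonoM mulr1 addNr.
  have y0 : hmono 1 1 != 0 :> hahn k.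
    by apply: contra_eq_neq E => ->; rewrite mulr0 eq_sym oner_eq0.
  by apply: (mulIf y0); rewrite E mulVf.
exact: (subfieldV hK base_y).
Qed.

Lemma base_proot n x : K x -> K (proot p n x).
Proof.
elim: n x => [|n IH] x Kx; first by rewrite proot0.
have [z Kz zx] := hperf pH (IH _ Kx).
suff -> : proot p n.+1 x = z by [].
by apply: proot_eq => //; rewrite expnS exprM zx prootK.
Qed.

Lemma base_ymono n : K (ymono k p n).
Proof. by rewrite -proot_ymono//; apply: base_proot; exact: base_yV. Qed.

Lemma base_alpha_part n : K (alpha_part k p n).
Proof. by apply: (subfield_sum hK) => j _; exact: base_ymono. Qed.

Lemma base_theta_part n : K (theta_part k p n).
Proof. by apply: (subfield_sum hK) => j _; exact: base_alpha_part. Qed.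

Lemma base_infinite n : exists s : seq (subfield_type hK), uniq s /\ (n < size s)%N.
Proof.
have Ky m : K (hmono 1 m%:R).
  have -> : hmono 1 m%:R = hmono 1 1 ^+ m :> hahn k by rewrite hmono_pow expr1n.
  by apply: (subfieldX hK); exact: base_y.
have /choice[f fP] m : exists a : subfield_type hK, val a = hmono 1 m%:R.
  exact: subfield_lift.
exists (map f (iota 0 n.+1)); split; last by rewrite size_map size_iota.
rewrite map_inj_uniq ?iota_uniq// => i j fij.
have : hmono 1 i%:R = hmono 1 j%:R :> hahn k by rewrite -!fP fij.
move=> /hahnP/(_ i%:R); rewrite hcoef_hmono /= /hmono_fun.
by case: eqP => [/eqP|_ /eqP]; rewrite ?eqr_nat ?oner_eq0// => /eqP.
Qed.

(** Otherwise infinitely many exponents -1/p^n lie in the support, which then accumulates at 0. *)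
Lemma base_support a : K a ->
  exists N, forall n, (N <= n)%N -> a (- (p ^ n)%:R^-1) = 0.
Proof.
move=> Ka; apply: contrapT => noN.
have frequent N : exists2 n, (N <= n)%N & a (- (p ^ n)%:R^-1) != 0.
  apply: contrapT => H; apply: noN; exists N => n Nn; apply/eqP.
  by apply: contrapT => /negP an; apply: H; exists n.
have : limit_point ([set ratr q | q in supp a] : set R) 0.
  move=> U /nbhs_ballP[e /= e0 eU].
  pose N := Num.truncn e^-1.
  have [n Nn an] := frequent N.+1.
  have pX : 0 < (p ^ n)%:R :> R by rewrite ltr0n expn_gt0 p_gt0.
  exists (ratr (- (p ^ n)%:R^-1)); split.
  - by rewrite rmorphN fmorphV rmorph_nat oppr_eq0 invr_eq0 gt_eqF.
  - by exists (- (p ^ n)%:R^-1).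
  - apply: eU; rewrite /ball /= sub0r normrN rmorphN fmorphV rmorph_nat normrN.
    rewrite gtr0_norm ?invr_gt0// -[e]invrK ltf_pV2 ?posrE ?invr_gt0//.
    apply: (lt_le_trans (truncnS_gt e^-1)).
    by rewrite ler_nat (leq_trans Nn)// ltnW// ltn_expl.
by rewrite hlim.
Qed.

Lemma alpha_far a : K a -> vge 0 (alpha - a) -> False.
Proof.
move=> /base_support[N aN] /(_ (- (p ^ N.+1)%:R^-1)).
rewrite oppr_lt0 invr_gt0 ltr0n expn_gt0 p_gt0 => /(_ isT) /eqP.
by rewrite hcoefB aN// alpha_coef// subr0 oner_eq0.
Qed.

Lemma alpha_notin : ~ K alpha.
Proof. by move=> Ka; apply: (alpha_far Ka); rewrite subrr. Qed.

(** The coefficient at -1/p^(n+1) is n - c, which cannot vanish for two consecutive n. *)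
Lemma theta_alpha_notin c : ~ K (theta - hconst c * alpha).
Proof.
move=> /base_support[N aN].
have E n : (N <= n)%N -> n%:R = c.
  move=> Nn; have := aN n.+1 (leqW Nn); rewrite hcoefB hcoef_monoM subr0.
  by rewrite alpha_coef// theta_coef// mulr1 => /eqP; rewrite subr_eq0 => /eqP.
have := E N.+1 (leqnSn N); rewrite -natr1 (E N (leqnn _)) => /eqP.
by rewrite -subr_eq0 addrAC subrr add0r oner_eq0.
Qed.

Local Notation alg := (algebraicOver (val : subfield_type hK -> hahn k)).

Lemma alg_has_degree x n : has_degree K x n -> alg x.
Proof.
move=> [f [fm /(subfield_lift_poly hK)[g gE] fx _] _]; exists g; rewrite ?gE//.
by rewrite -(map_poly_eq0 (val : {rmorphism subfield_type hK -> hahn k})) gE monic_neq0.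
Qed.

Lemma alg_base x : K x -> alg x.
Proof. by move=> /(subfield_lift hK)[a <-]; exact: algebraic_id. Qed.

Lemma alg_artin_schreier x : alg (x ^+ p - x) -> alg x.
Proof. exact: algebraic_artin_schreier. Qed.

Lemma alg_alpha : alg alpha.
Proof. by apply: alg_artin_schreier; rewrite alpha_eq//; apply: alg_base; exact: base_yV. Qed.

Lemma alg_theta : alg theta.
Proof. by apply: alg_artin_schreier; rewrite theta_eq//; exact: alg_alpha. Qed.

Lemma alg_eta : alg eta.
Proof.
by apply: alg_artin_schreier; rewrite eta_eq// expr2; apply: algebraic_mul; exact: alg_alpha.
Qed.

(** Perfectness of K makes algebraic elements separable, and all their conjugates lie in the
    algebraically closed Hahn field. *)
Lemma hahn_galois (bs : seq (hahn k)) : (forall b, b \in bs -> alg b) ->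
  exists (L : splittingFieldType (subfield_type hK)) (phi : {rmorphism L -> hahn k}),
  [/\ forall a : subfield_type hK, phi a%:A = val a,
      forall b, b \in bs -> exists x : L, phi x = b & galois 1 {:L}].
Proof.
move=> bsP.
have pKt : p \in [pchar subfield_type hK].
  rewrite inE p_prime; apply/eqP/val_inj; rewrite rmorph_nat rmorph0.
  exact: pcharf0.
have pth (a : subfield_type hK) : exists b, b ^+ p = a.
  have [z Kz za] := hperf pH (subfield_valP a).
  by have [b bz] := subfield_lift hK Kz; exists b; apply: val_inj; rewrite rmorphXn /= bz.
have [qs [sep_qs qsP]] : exists qs : seq {poly subfield_type hK},
    all separable_poly qs /\ forall b, b \in bs ->
    exists2 q, q \in qs & root (map_poly val q) b.
  elim: bs bsP => [|b bs IH] bsP; first by exists [::].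
  have [|qs [sep_qs qsP]] := IH; first by move=> c cbs; apply: bsP; rewrite inE cbs orbT.
  have [q q0 qb] := bsP b (mem_head _ _).
  have [r sep_r rb] := perfect_separable pKt pth q0 qb.
  exists (r :: qs); split => /=; first by rewrite sep_r.
  move=> c; rewrite inE => /orP[/eqP->|/qsP[s sqs sc]].
    by exists r => //; exact: mem_head.
  by exists s => //; rewrite inE sqs orbT.
have [L [phi [phiA phiP galL]]] := @galois_closure _ _ (val : {rmorphism subfield_type hK -> hahn k})
  (@hahn_closed k) base_infinite qs sep_qs.
by exists L, phi; split => // b /qsP[q /phiP]; apply.
Qed.

End Base.

(** * The polynomial X^p - X and interpolation on the prime field *)

Section ArtinSchreierPoly.
Variables (F : fieldType) (p : nat).
Hypothesis pF : p \in [pchar F].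

Lemma natr_ord_inj : injective (fun i : 'I_p => i%:R : F).
Proof.
have sub (i j : 'I_p) : (i <= j)%N -> i%:R = j%:R :> F -> i = j.
  move=> ij /eqP; rewrite eq_sym -subr_eq0 -natrB// -(dvdn_pcharf pF) => pij.
  apply/val_inj/eqP; rewrite eqn_leq ij /= -subn_eq0.
  move: pij; rewrite dvdn_eq divn_small ?mul0n 1?eq_sym//.
  by apply: leq_ltn_trans (ltn_ord j); exact: leq_subr.
move=> i j /= ijE; have [ij|/ltnW ij] := leqP i j; first exact: sub.
by apply/esym/sub.
Qed.

Lemma prod_XsubC_natr : \prod_(i < p) ('X - i%:R%:P) = 'X^p - 'X :> {poly F}.
Proof.
have p_gt1 : (1 < p)%N by apply: prime_gt1; exact: pcharf_prime pF.
pose rs := [seq (i%:R : F) | i : 'I_p <- enum 'I_p].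
have szf : size ('X^p - 'X : {poly F}) = p.+1.
  by rewrite size_polyDl ?size_polyN ?size_polyX size_polyXn.
have lead : lead_coef ('X^p - 'X : {poly F}) = 1.
  by rewrite lead_coefDl ?lead_coefXn// size_polyN size_polyX size_polyXn.
have := @all_roots_prod_XsubC _ ('X^p - 'X) rs.
rewrite lead scale1r /rs big_map big_enum => ->//.
- by rewrite szf size_map size_enum_ord.
- apply/allP => _ /mapP[i _ ->]; rewrite /root !hornerE.
  by rewrite -(pFrobenius_autE pF) (pFrobenius_aut_nat pF) subrr.
- by rewrite uniq_rootsE map_inj_uniq ?enum_uniq//; exact: natr_ord_inj.
Qed.

(* Lagrange interpolation of the constant -1 at the points of the prime field,
   where the derivative of X^p - X equals -1. *)
Lemma sum_prod_natr (w : F) :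
  \sum_(i < p) \prod_(j < p | j != i) (w - j%:R) = -1.
Proof.
pose g (i : 'I_p) : {poly F} := \prod_(j < p | j != i) ('X - j%:R%:P).
pose H := \sum_i g i + 1.
have gE i x : (g i).[x] = \prod_(j < p | j != i) (x - j%:R).
  by rewrite horner_prod; apply: eq_bigr => j _; rewrite hornerXsubC.
suff H0 : H = 0.
  apply/eqP; rewrite -subr_eq0 opprK; apply/eqP; transitivity H.[w].
    by rewrite hornerD hornerC horner_sum; congr (_ + _); apply: eq_bigr => i _; rewrite gE.
  by rewrite H0 horner0.
have p_gt0 : (0 < p)%N by apply: prime_gt0; exact: pcharf_prime pF.
have szf : size ('X^p - 'X : {poly F}) = p.+1.
  rewrite size_polyDl ?size_polyN ?size_polyX size_polyXn// ltnS.
  by apply: prime_gt1; exact: pcharf_prime pF.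
have fE (i : 'I_p) : 'X^p - 'X = ('X - i%:R%:P) * g i.
  by rewrite -prod_XsubC_natr (bigD1 i).
have sg (i : 'I_p) : size (g i) = p.
  have gm : g i \is monic by rewrite monic_prod_XsubC.
  apply/eqP; rewrite -eqSS -szf (fE i) size_Mmonic ?polyXsubC_eq0//.
  by rewrite size_XsubC.
have gi (m : 'I_p) : (g m).[m%:R] = -1.
  have := congr1 (fun f : {poly F} => f^`().[m%:R]) (fE m).
  rewrite derivM derivB derivXn derivX derivXsubC mul1r.
  rewrite !hornerE ?hornerMn.
  rewrite subrr mul0r addr0 -[_ *+ p]mulr_natr. by rewrite (pcharf0 pF) mulr0 sub0r => <-.
have szH : (size H <= p)%N.
  apply: leq_trans (size_polyD _ _) _; rewrite geq_max size_poly1 p_gt0 andbT.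
  by apply: (leq_trans (size_sum _ _ _)); apply/bigmax_leqP => i _; rewrite sg.
apply: contraTeq szH => H0; rewrite -ltnNge.
pose rs := [seq (i%:R : F) | i : 'I_p <- enum 'I_p].
have -> : p = size rs by rewrite size_map size_enum_ord.
apply: max_poly_roots => //; last first.
  by rewrite map_inj_uniq ?enum_uniq//; exact: natr_ord_inj.
apply/allP => _ /mapP[i _ ->]; rewrite /root hornerD hornerC horner_sum.
rewrite (bigD1 i)//= gi big1 ?addr0 ?addNr// => j ji.
by rewrite gE (bigD1 i) 1?eq_sym//= subrr mul0r.
Qed.

End ArtinSchreierPoly.

(** * The Galois group of N/K and its action on valuations *)

Section Conjugates.
Variables (R : realType) (k : closedFieldType) (p : nat).
Hypotheses (pk : p \in [pchar k]) (p_gt2 : (2 < p)%N).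
Variables (K : set (hahn k)) (hK : is_subfield K).
Hypotheses (hkK : ratfuns k `<=` K) (hhens : henselian K).
Hypotheses (hperf : perfect_subfield K) (hlim : no_finite_limits R K).

Local Notation alpha := (alpha k p).
Local Notation theta := (theta k p).
Local Notation eta := (eta k p).

Let p_prime : prime p. Proof. exact: pcharf_prime pk. Qed.
Let p_gt0 : (0 < p)%N. Proof. exact: prime_gt0. Qed.
Let p_gt1 : (1 < p)%N. Proof. exact: prime_gt1. Qed.
Let pH : p \in [pchar hahn k]. Proof. exact: pchar_hahn. Qed.

Let two_neq0 : 2%:R != 0 :> k.
Proof.
rewrite -(dvdn_pcharf pk); apply/negP => /dvdn_leq => /(_ isT).
by rewrite leqNgt p_gt2.
Qed.

Variables (L : splittingFieldType (subfield_type hK)) (phi : {rmorphism L -> hahn k}).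
Hypothesis phiA : forall a : subfield_type hK, phi a%:A = val a.
Hypothesis galL : galois 1 {:L}.
Local Notation G := (gal_of {:L}).
Implicit Types (x y : L) (s : G).

Definition kcst (c : k) : L :=
  in_alg L (Subfield (mem_set (base_const hkK c) : _ \in subfield_pred hK)).

Lemma phi_kcst c : phi (kcst c) = hconst c. Proof. exact: phiA. Qed.

Lemma gal_kcst s c : s (kcst c) = kcst c.
Proof. by apply: gal_base; apply/vlineP; eexists. Qed.

Variables (a t h : L).
Hypotheses (aE : phi a = alpha) (tE : phi t = theta) (hE : phi h = eta).

Definition conj_by s (i c d : k) :=
  [/\ s a = a + kcst i, s t = t + kcst c, s h = h + kcst (i *+ 2) * t + kcst d &
  [/\ i ^+ p = i, c ^+ p - c = i & d ^+ p - d = i ^+ 2]].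

Lemma conj_ex s : exists i c d, conj_by s i c d.
Proof.
have phiG x y : phi (x ^+ p - x) = phi y -> phi (s x) ^+ p - phi (s x) = phi (s y).
  by move=> /fmorph_inj <-; rewrite !rmorphB !rmorphXn.
have [ya ya1 yaE] := base_lift phiA (base_yV hK hkK).
have Ea : phi (s a) ^+ p - phi (s a) = hmono 1 (-1).
  by rewrite (phiG _ ya) ?(gal_base s ya1)// rmorphB rmorphXn yaE aE /= (alpha_eq pk).
have [xa ia] : phi (s a) - alpha = hconst ((phi (s a) - alpha) 0) /\
    ((phi (s a) - alpha) 0) ^+ p - (phi (s a) - alpha) 0 = 0.
  apply: artin_schreier_const => //; rewrite (pexpB pk) rmorph0.
  transitivity (phi (s a) ^+ p - phi (s a) - (alpha ^+ p - alpha)); first by ring.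
  by rewrite Ea (alpha_eq pk) subrr.
set i := (phi (s a) - alpha) 0 in xa ia.
have {}ia : i ^+ p = i by apply/eqP; rewrite -subr_eq0 ia.
have saE : phi (s a) = alpha + hconst i by rewrite -xa; ring.
have Et : phi (s t) ^+ p - phi (s t) = phi (s a).
  by rewrite (phiG _ a)// rmorphB rmorphXn tE aE /= (theta_eq pk).
have [xt ct] : phi (s t) - theta = hconst ((phi (s t) - theta) 0) /\
    ((phi (s t) - theta) 0) ^+ p - (phi (s t) - theta) 0 = i.
  apply: artin_schreier_const => //; rewrite (pexpB pk).
  transitivity (phi (s t) ^+ p - phi (s t) - (theta ^+ p - theta)); first by ring.
  by rewrite Et (theta_eq pk) saE; ring.
set c := (phi (s t) - theta) 0 in xt ct.
have stE : phi (s t) = theta + hconst c by rewrite -xt; ring.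
have Eh : phi (s h) ^+ p - phi (s h) = phi (s a) ^+ 2.
  rewrite (phiG _ (a ^+ 2)); first by rewrite !rmorphXn.
  by rewrite rmorphB !rmorphXn hE aE /= (eta_eq pk).
(* Subtracting 2 i theta absorbs the cross term of (alpha + i)^2, which leaves X^p - X = i^2, a
   constant. *)
pose X := phi (s h) - eta - hconst (i *+ 2) * theta.
have [xh dh] : X = hconst (X 0) /\ (X 0) ^+ p - X 0 = i ^+ 2.
  apply: artin_schreier_const => //; rewrite /X !(pexpB pk) exprMn.
  have -> : hconst (i *+ 2) ^+ p = hconst (i *+ 2).
    by rewrite -rmorphXn -(pFrobenius_autE pk) rmorphMn /= pFrobenius_autE ia.
  transitivity (phi (s h) ^+ p - phi (s h) - (eta ^+ p - eta)
    - hconst (i *+ 2) * (theta ^+ p - theta)); first by ring.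
  rewrite Eh (eta_eq pk) (theta_eq pk) saE rmorphMn rmorphXn /=; ring.
exists i, c, (X 0); split=> //; apply: (fmorph_inj phi).
- by rewrite rmorphD saE aE phi_kcst.
- by rewrite rmorphD stE tE phi_kcst.
- by rewrite !rmorphD rmorphM hE tE !phi_kcst /= -xh /X; ring.
Qed.

Lemma kcst_inj : injective kcst.
Proof. by move=> c d /(congr1 phi); rewrite !phi_kcst; exact: fmorph_inj. Qed.

Lemma kcst0 : kcst 0 = 0. Proof. by apply: (fmorph_inj phi); rewrite phi_kcst !rmorph0. Qed.

Lemma commutator_ex : exists s1 s2 (u := (s1 * s2)%g) (w := (s2 * s1)%g)
  (tau := (u * w^-1)%g), exists e, [/\ e != 0, e ^+ p = e, tau a = a, tau t = t &
  tau h = h + kcst e].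
Proof.
have [s1 s1a] : exists s1, s1 a != a.
  apply: contrapT => H; apply: (alpha_notin pk hlim); rewrite -aE.
  apply: (phi_base phiA); apply: (gal_fixed_base galL) => s; apply/eqP.
  by apply: contrapT => /negP sa; apply: H; exists s.
have [i1 [c1 [d1 [a1 t1 h1 _]]]] := conj_ex s1.
have i1_neq0 : i1 != 0 by apply: contraNneq s1a => i0; rewrite a1 i0 kcst0 addr0.
(* [s1] fixes this element. That [s2] moves it says that (i1, c1) and (i2, c2) are linearly
   independent, so the translation e = 2 (i1 c2 - i2 c1) of the commutator is nonzero. *)
have [s2 s2t] : exists s2, s2 (t - kcst (c1 / i1) * a) != t - kcst (c1 / i1) * a.
  apply: contrapT => H; apply: (theta_alpha_notin pk hlim (c := c1 / i1)).
  rewrite -tE -aE -phi_kcst -rmorphM -rmorphB.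
  apply: (phi_base phiA); apply: (gal_fixed_base galL) => s; apply/eqP.
  by apply: contrapT => /negP sa; apply: H; exists s.
have [i2 [c2 [d2 [a2 t2 h2 _]]]] := conj_ex s2.
have {}s2t : c2 - c1 / i1 * i2 != 0.
  apply: contraNneq s2t => E; rewrite rmorphB rmorphM /= gal_kcst a2 t2.
  apply/eqP/(fmorph_inj phi); rewrite !(rmorphB, rmorphD, rmorphM) /= !phi_kcst.
  have {}E : hconst c2 = hconst (c1 / i1) * hconst i2.
    by rewrite -rmorphM; congr hconst; apply/eqP; rewrite -subr_eq0 E.
  by rewrite E; ring.
pose e := i1 *+ 2 * c2 - i2 *+ 2 * c1.
have uw x c : s2 (s1 x) = s1 (s2 x) + kcst c ->
    (s1 * s2 * (s2 * s1)^-1)%g x = x + kcst c.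
  move=> E; rewrite !galMx E -galMx rmorphD /= gal_kcst.
  by rewrite -galMx mulgV gal_id.
exists s1, s2; rewrite /=; set tau := (s1 * s2 * _)%g.
have ta : tau a = a.
  rewrite -[RHS]addr0 -kcst0; apply: uw; rewrite a1 a2 !rmorphD /= !gal_kcst a1 a2 kcst0.
  ring.
have tt : tau t = t.
  rewrite -[RHS]addr0 -kcst0; apply: uw; rewrite t1 t2 !rmorphD /= !gal_kcst t1 t2 kcst0.
  ring.
have th : tau h = h + kcst e.
  apply: uw; rewrite h1 h2 !(rmorphD, rmorphM) /= !gal_kcst t1 t2 h1 h2.
  have -> : kcst e = kcst (i1 *+ 2) * kcst c2 - kcst (i2 *+ 2) * kcst c1.
    by apply: (fmorph_inj phi); rewrite !(rmorphB, rmorphM) /= !phi_kcst -!rmorphM -rmorphB.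
  ring.
exists e; split => //.
  have -> : e = 2%:R * i1 * (c2 - c1 / i1 * i2).
    by rewrite /e; field.
  by rewrite !mulf_neq0.
(* Since tau fixes alpha, its parameter i is 0, and the relation d^p - d = i^2 puts e in the prime
   field. *)
have [i [c [d [ai ti hi [_ _ de]]]]] := conj_ex tau.
have i0 : i = 0.
  by apply: kcst_inj; apply: (addrI a); rewrite -ai ta kcst0 addr0.
have dE : d = e.
  apply: kcst_inj; apply: (addrI h); rewrite -th hi i0 mul0rn kcst0 mul0r addr0.
  by [].
by move: de; rewrite i0 expr0n dE => /eqP; rewrite subr_eq0 => /eqP.
Qed.

(** The leading monomial of x lies in K and cancels in s x - x, which makes the bound strict. *)
Lemma gal_sub_vgt s q x : (forall c, K (hmono c q)) -> vge q (phi x) ->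
  vgt q (phi (s x) - phi x).
Proof.
move=> Kq vx; have [m m1 mE] := base_lift phiA (Kq (phi x q)).
have vxm : vgt q (phi (x - m)).
  rewrite rmorphB mE; split; first by apply: vgeB => //; exact: vge_hmono.
  by rewrite hcoefB hcoef_hmono subrr.
have -> : phi (s x) - phi x = phi (s (x - m)) - phi (x - m).
  by rewrite rmorphB /= (gal_base s m1) !rmorphB; ring.
by apply: vgtB => //; exact: (gal_vgt hhens phiA galL).
Qed.

(* [inN x] : x belongs to the field K(theta, eta), seen inside L *)
Definition inN x := forall s, s a = a -> s t = t -> s h = h -> s x = x.

(** N/K is normal: by the shape of the action, a conjugate of an automorphism fixing a, t and h
    fixes them too. *)
Lemma inN_gal s x : inN x -> inN (s x).
Proof.
move=> Nx u ua ut uh; have [i [c [d [sa st sh _]]]] := conj_ex s.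
have E : (s * u * s^-1)%g x = x.
  have back y : u (s y) = s y -> (s * u * s^-1)%g y = y.
    by move=> uy; rewrite !galMx uy -galMx mulgV gal_id.
  apply: Nx; apply: back.
  - by rewrite sa rmorphD /= gal_kcst ua.
  - by rewrite st rmorphD /= gal_kcst ut.
  - by rewrite sh !rmorphD rmorphM /= !gal_kcst ut uh.
have := congr1 s E; rewrite galMx -[X in X = _]galMx mulVg gal_id.
by rewrite galMx.
Qed.

Let pL : p \in [pchar L].
Proof. by rewrite inE p_prime; apply/eqP/(fmorph_inj phi); rewrite rmorph_nat rmorph0 pcharf0. Qed.

Lemma gal_expS s n x : (s ^+ n.+1)%g x = s ((s ^+ n)%g x).
Proof. by rewrite expgSr galMx. Qed.

Lemma gal_exp_translation s x c n : s x = x + kcst c -> (s ^+ n)%g x = x + kcst c *+ n.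
Proof.
move=> sx; elim: n => [|n IH]; first by rewrite expg0 gal_id addr0.
by rewrite gal_expS IH rmorphD rmorphMn /= gal_kcst sx -addrA -mulrS.
Qed.

Lemma gal_exp_p s x c : s x = x + kcst c -> (s ^+ p)%g x = x.
Proof.
move=> /gal_exp_translation ->.
by rewrite -mulr_natr pcharf0// mulr0 addr0.
Qed.

(** s^p fixes a and t, hence translates h by a constant, and a further p-th power removes this
    translation. *)
Lemma gal_exp_pp s x : inN x -> (s ^+ (p ^ 2))%g x = x.
Proof.
move=> Nx; have [i [c [d [sa st sh _]]]] := conj_ex s.
have spa := gal_exp_p sa; have spt := gal_exp_p st.
have [i' [c' [d' [pa _ ph _]]]] := conj_ex (s ^+ p)%g.
have i'0 : i' = 0.
  by apply: kcst_inj; apply: (addrI a); rewrite -pa spa kcst0 addr0.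
rewrite i'0 mul0rn kcst0 mul0r addr0 in ph.
rewrite -mulnn expgM; apply: Nx; last exact: gal_exp_p ph.
  by apply: (@gal_exp_p _ _ 0); rewrite kcst0 addr0.
by apply: (@gal_exp_p _ _ 0); rewrite kcst0 addr0.
Qed.

(* s acts on the leading coefficients at q by a character of order prime to p;
   it is trivial because s has p-power order on K(theta, eta). *)
Lemma gal_coef s q x : inN x -> vge q (phi x) -> phi (s x) q = phi x q.
Proof.
move=> Nx vx; have [x0|x0] := eqVneq (phi x q) 0.
  by have [_ ->] := gal_vgt hhens phiA galL s (conj vx x0).
set r := phi (s x) q / phi x q.
have step n : phi ((s ^+ n)%g x) q = r ^+ n * phi x q.
  elim: n => [|n IH]; first by rewrite expg0 gal_id mul1r.
  pose y := (s ^+ n)%g x - kcst (r ^+ n) * x.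
  have phiM c z : phi (kcst c * z) q = c * phi z q.
    by rewrite rmorphM phi_kcst hcoef_monoM subr0.
  have vy : vgt q (phi y).
    split; last by rewrite rmorphB hcoefB phiM IH subrr.
    rewrite rmorphB; apply: vgeB; first exact: (gal_vge hhens phiA galL).
    rewrite rmorphM phi_kcst -[q]add0r; apply: vgeM => //; exact: vge_const.
  have [_] := gal_vgt hhens phiA galL s vy.
  rewrite rmorphB rmorphM /= gal_kcst rmorphB hcoefB phiM -gal_expS => /eqP.
  rewrite subr_eq0 => /eqP ->.
  by rewrite exprSr -mulrA /r divfK.
have : r ^+ (p ^ 2) = 1.
  by apply: (mulIf x0); rewrite mul1r -step gal_exp_pp.
rewrite -mulnn exprM => /(pth_power1 pk)/(pth_power1 pk) r1.
by rewrite -[phi (s x) q](divfK x0) -/r r1 mul1r.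
Qed.

Variables (B C : nat -> L).
Hypothesis BE : forall n, B n \in 1%VS /\ phi (B n) = theta_part k p n.
Hypothesis CE : forall n, C n \in 1%VS /\
  phi (C n) = \sum_(j < n) alpha_part k p j.+1 ^+ 2.

Lemma eta_tail n : (p %| n)%N -> phi (h - (C n - a * B n *+ 2)) = proot p n eta.
Proof.
move=> pn; have [[_ bE] [_ cE]] := (BE n, CE n).
rewrite !rmorphB rmorphMn rmorphM hE aE bE cE /=.
by rewrite {1}(eta_expand_dvd pk pn) addrK.
Qed.

(* Trace argument over the fixed field of tau: w is an Artin-Schreier generator
   with w^tau = w - 1, and f = - sum_i tau^i(z) prod_(j <> i) (w - j). *)
Lemma average (tau : G) e z q n : (p %| n)%N -> tau a = a -> tau t = t ->
    tau h = h + kcst e -> e != 0 -> inN z -> vge q (phi (tau z) - phi z) ->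
  exists f, [/\ tau f = f, inN f & vge (q - (p ^ n)%:R^-1 *+ p) (phi z - phi f)].
Proof.
move=> pn ta tt th e0 Nz vz; have [[b1 bE] [c1 cE]] := (BE n, CE n).
(* [g] is the tail of eta, of valuation at least -1/p^n. It differs from h by an element fixed by
   tau, so tau moves it by e as well. *)
pose g := h - (C n - a * B n *+ 2); pose w := - g * kcst e^-1.
have gfix s : s a = a -> s h = h -> s g = g.
  move=> sa sh; rewrite !rmorphB rmorphMn rmorphM /= sa sh.
  by rewrite (gal_base s b1) (gal_base s c1).
have tg : tau g = g + kcst e.
  rewrite !rmorphB rmorphMn rmorphM /= ta th (gal_base _ b1) (gal_base _ c1) /g; ring.
have tw : tau w = w - 1.
  rewrite rmorphM rmorphN /= gal_kcst tg /w.
  have -> : 1 = kcst e * kcst e^-1.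
    by apply: (fmorph_inj phi); rewrite rmorphM !phi_kcst -rmorphM divff// !rmorph1.
  ring.
have vw : vge (- (p ^ n)%:R^-1) (phi w).
  rewrite rmorphM rmorphN eta_tail// phi_kcst -[X in vge X]addr0.
  apply: vgeM; last exact: vge_const.
  by apply: vgeN; have := @proot_vge _ _ pk n _ _ (vge_eta pk); rewrite mulN1r.
have Nw : inN w by move=> s sa st sh; rewrite rmorphM rmorphN /= gal_kcst gfix.
pose H (i : 'I_p) := \prod_(j < p | j != i) (w - j%:R).
pose f := - \sum_i H i * (tau ^+ i)%g z.
have sumH : \sum_i H i = -1 by exact: sum_prod_natr.
(* tau shifts the factors w - j cyclically; so it permutes the terms of f, which is therefore
   invariant. *)
have tauH i : tau (H i) = H (ordS i).
  rewrite rmorph_prod /= /H [RHS](reindex_inj (@ordS_inj p)) /=.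
  apply: eq_big => [j|j _]; first by rewrite (inj_eq (@ordS_inj p)).
  rewrite rmorphB rmorph_nat /= tw (GRing.natr_mod_pchar pL) -natr1; ring.
have tauZ (i : 'I_p) : tau ((tau ^+ i)%g z) = (tau ^+ ordS i)%g z.
  rewrite -gal_expS /=; have := ltn_ord i; rewrite leq_eqVlt => /orP[/eqP ip|ip].
    rewrite ip modnn expg0 gal_id; apply: Nz; last exact: gal_exp_p th.
      by apply: (@gal_exp_p _ _ 0); rewrite kcst0 addr0.
    by apply: (@gal_exp_p _ _ 0); rewrite kcst0 addr0.
  by rewrite modn_small.
have diff m : vge q (phi ((tau ^+ m)%g z) - phi z).
  elim: m => [|m IH]; first by rewrite expg0 gal_id subrr.
  rewrite gal_expS; have -> : phi (tau ((tau ^+ m)%g z)) - phi z =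
      phi (tau ((tau ^+ m)%g z - z)) + (phi (tau z) - phi z).
    by rewrite !rmorphB /=; ring.
  by apply: vgeD => //; apply: (gal_vge hhens phiA galL); rewrite rmorphB.
exists f; split.
- rewrite rmorphN rmorph_sum /= /f [in RHS](reindex_inj (@ordS_inj p)) /=.
  by congr (- _); apply: eq_bigr => i _; rewrite rmorphM /= tauH tauZ.
- move=> s sa st sh; rewrite rmorphN rmorph_sum /=; congr (- _).
  apply: eq_bigr => i _; rewrite rmorphM rmorph_prod /=; congr (_ * _).
    by apply: eq_bigr => j _; rewrite rmorphB rmorph_nat /= Nw.
  by apply: inN_gal.
(* As the [H i] sum to -1, z can be moved inside the sum. Each [H i] has fewer than p factors, each
   costing at most 1/p^n in valuation. *)
- have -> : phi z - phi f = \sum_i phi (H i) * (phi ((tau ^+ i)%g z) - phi z).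
    under eq_bigr do rewrite -rmorphB -rmorphM mulrBr.
    rewrite -rmorph_sum -rmorphB sumrB -mulr_suml sumH /f; congr (phi _); ring.
  apply: vge_sum => i _; rewrite addrC; apply: vgeM => //.
  have pn0 : 0 < (p ^ n)%:R^-1 :> rat by rewrite invr_gt0 ltr0n expn_gt0 p_gt0.
  rewrite /H rmorph_prod; apply: (@vge_le _ _ (\sum_(j < p | j != i) - (p ^ n)%:R^-1)).
    rewrite sumrN lerN2 sumr_const; apply: ler_wpMn2l; first exact: ltW.
    by rewrite -[X in (_ <= X)%N](card_ord p) max_card.
  apply: vge_prod => j _; rewrite rmorphB rmorph_nat; apply: vgeB => //.
  apply: (@vge_le _ _ 0); first by rewrite oppr_le0 ltW.
  exact/vgeMn/vge1.
Qed.

Variables (kap : k) (kapP : kap ^+ p != kap).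

Local Notation zeta := (eta + hconst kap * theta).
Local Notation z := (h + kcst kap * t).

Lemma phi_zeta : phi z = zeta.
Proof. by rewrite rmorphD rmorphM phi_kcst hE tE. Qed.

Lemma gal_zeta s : s z = s h + kcst kap * s t.
Proof. by rewrite rmorphD rmorphM /= gal_kcst. Qed.

(** The coefficient of y^(-1/p^2) in s z - z is 2 i. *)
Lemma zeta_close_alpha s :
  vgt (- (p ^ 2)%:R^-1) (phi (s z) - phi z) -> s a = a.
Proof.
have [i [c [d [sa st sh _]]]] := conj_ex s.
have q0 : - (p ^ 2)%:R^-1 < 0 :> rat by rewrite oppr_lt0 invr_gt0 ltr0n expn_gt0 p_gt0.
have -> : phi (s z) - phi z =
    hconst (i *+ 2) * theta + hconst (d + kap * c).
  rewrite gal_zeta st sh !(rmorphD, rmorphM) /= !phi_kcst hE tE.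
  by rewrite (rmorphMn _ 2 i); ring.
move=> [_]; rewrite hcoefD hcoef_monoM subr0 theta_coef// vge_const// mulr1 addr0.
rewrite -mulr_natr => /eqP; rewrite mulf_eq0 (negPf two_neq0) orbF => /eqP i0.
by rewrite sa i0 kcst0 addr0.
Qed.

(** Once i = 0, the difference s z - z is the constant d + kap c with c and d in the prime field; it
    vanishes only for c = d = 0 because kap lies outside that field. *)
Lemma zeta_close s : vgt 0 (phi (s z) - phi z) -> [/\ s a = a, s t = t & s h = h].
Proof.
move=> v0; have q0 : - (p ^ 2)%:R^-1 <= 0 :> rat by rewrite oppr_le0 invr_ge0 ler0n.
have sa := zeta_close_alpha (vgt_le q0 v0).
have [i [c [d [sa' st sh [_ ci di]]]]] := conj_ex s.
have i0 : i = 0 by apply: kcst_inj; apply: (addrI a); rewrite -sa' sa kcst0 addr0.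
rewrite i0 mul0rn kcst0 mul0r addr0 in sh; rewrite i0 in ci; rewrite i0 expr0n /= in di.
have cp : c ^+ p = c by apply/eqP; rewrite -subr_eq0 ci.
have dp : d ^+ p = d.
  by apply/eqP; rewrite -subr_eq0 di; case: (p) p_gt0.
have dc : d + kap * c = 0.
  move: v0 => [_]; rewrite -rmorphB gal_zeta st sh.
  have -> : h + kcst d + kcst kap * (t + kcst c) - (h + kcst kap * t) = kcst (d + kap * c).
    apply: (fmorph_inj phi); rewrite phi_kcst.
    rewrite [RHS](_ : _ = hconst d + hconst kap * hconst c); last first.
      by rewrite rmorphD rmorphM.
    by rewrite !(rmorphB, rmorphD, rmorphM) /= !phi_kcst; ring.
  by rewrite phi_kcst hcoef_const.
have [c0|c0] := eqVneq c 0.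
  by move: dc; rewrite c0 mulr0 addr0 => d0; rewrite st sh c0 d0 kcst0 !addr0.
exfalso; move/eqP: kapP; apply.
have -> : kap = - d / c by apply: (mulIf c0); rewrite divfK//; apply/eqP; rewrite -addr_eq0 addrC dc.
by rewrite expr_div_n cp -(pFrobenius_autE pk) rmorphN /= pFrobenius_autE dp.
Qed.

(** Krasner's argument: if s fixes y, then s z - z = s (z - y) - (z - y) has valuation greater than
    q, so s fixes x. *)
Lemma close_adjoin x y q : (forall c, K (hmono c q)) -> vge q (phi z - phi y) ->
  (forall s, vgt q (phi (s z) - phi z) -> s x = x) -> x \in <<1; y>>%VS.
Proof.
move=> Kq vzy sx; apply: (gal_adjoin galL) => s sy; apply: sx.
have := @gal_sub_vgt s q (z - y) Kq; rewrite !rmorphB /= sy => /(_ vzy).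
by congr vgt; ring.
Qed.

(** [alpha] is a root of X^p - X - y^(-1), and the powers of an s that moves it give p distinct
    conjugates. *)
Lemma alpha_degree : adjoin_degree 1 a = p.
Proof.
have [s sa0] : exists s, s a != a.
  apply: contrapT => H; apply: (alpha_notin pk hlim); rewrite -aE.
  apply: (phi_base phiA); apply: (gal_fixed_base galL) => s; apply/eqP.
  by apply: contrapT => /negP sa; apply: H; exists s.
have [i [c [d [sa _ _ _]]]] := conj_ex s.
have i0 : kcst i != 0 by apply: contraNneq sa0 => i0; rewrite sa i0 addr0.
have [y y1 yE] := base_lift phiA (base_yV hK hkK).
apply/eqP; rewrite eqn_leq; apply/andP; split.
  have fz : 'X^p - 'X - y%:P \is a polyOver 1%VS.
    by rewrite rpredB ?polyOverC// rpredB ?polyOverX// rpredX ?polyOverX.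
  have fa : root ('X^p - 'X - y%:P) a.
    rewrite /root !hornerE; apply/eqP/(fmorph_inj phi).
    by rewrite !rmorphB rmorphXn aE yE /= (alpha_eq pk) subrr rmorph0.
  have szf : size ('X^p - 'X - y%:P : {poly L}) = p.+1.
    rewrite -addrA size_polyDl size_polyXn// -opprD size_polyN ltnS.
    apply: leq_trans (size_polyD _ _) _.
    by rewrite size_polyX size_polyC; case: (y != 0) => //; rewrite maxnE.
  have := minPoly_dvdp fz fa => /dvdp_leq; rewrite szf size_minPoly ltnS; apply.
  by rewrite -size_poly_eq0 szf.
rewrite -ltnS -size_minPoly.
pose rs := [seq a + kcst i * j%:R | j : 'I_p <- enum 'I_p].
have -> : p = size rs by rewrite size_map size_enum_ord.
apply: max_poly_roots.
- by rewrite monic_neq0 ?monic_minPoly.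
- apply/allP => _ /mapP[j _ ->].
  rewrite mulr_natr -(gal_exp_translation j sa).
  have mE (g : G) : map_poly g (minPoly 1 a) = minPoly 1 a.
    apply/polyP => l; rewrite coef_map /= gal_base//.
    exact: (polyOverP (minPolyOver 1%AS a)).
  by rewrite -{1}(mE (s ^+ j)%g) fmorph_root root_minPoly.
- rewrite map_inj_uniq ?enum_uniq// => j l /addrI/(mulfI i0).
  exact: natr_ord_inj.
Qed.

End Conjugates.

(** * Computing the depth *)

Section Depth.
Variables (R : realType) (k : closedFieldType) (p : nat).
Hypotheses (pk : p \in [pchar k]) (p_gt2 : (2 < p)%N).
Variables (K : set (hahn k)) (hK : is_subfield K).
Hypotheses (hkK : ratfuns k `<=` K) (hhens : henselian K).
Hypotheses (hperf : perfect_subfield K) (hlim : no_finite_limits R K).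

Local Notation alpha := (alpha k p).
Local Notation theta := (theta k p).
Local Notation eta := (eta k p).
Local Notation alg := (algebraicOver (val : subfield_type hK -> hahn k)).
Local Notation N := (adjoin K [set theta; eta]).

Let p_prime : prime p. Proof. exact: pcharf_prime pk. Qed.
Let p_gt0 : (0 < p)%N. Proof. exact: prime_gt0. Qed.
Let p_gt1 : (1 < p)%N. Proof. exact: prime_gt1. Qed.

Lemma galois_setup (b : hahn k) : alg b ->
  exists (L : splittingFieldType (subfield_type hK)) (phi : {rmorphism L -> hahn k})
    (a t h y : L) (B C : nat -> L),
  [/\ (forall c : subfield_type hK, phi c%:A = val c) /\ galois 1 {:L},
      [/\ phi a = alpha, phi t = theta & phi h = eta],
      phi y = b,
      forall n, B n \in 1%VS /\ phi (B n) = theta_part k p n &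
      forall n, C n \in 1%VS /\ phi (C n) = \sum_(j < n) alpha_part k p j.+1 ^+ 2].
Proof.
move=> alg_b; have [|L [phi [phiA lift galL]]] :=
  @hahn_galois k p pk K hK hkK hperf [:: alpha; theta; eta; b].
  move=> c; rewrite !inE => /or4P[] /eqP -> //.
  - exact: alg_alpha.
  - exact: alg_theta.
  - exact: alg_eta.
have [a aE] : exists x, phi x = alpha by apply: lift; rewrite !inE eqxx.
have [t tE] : exists x, phi x = theta by apply: lift; rewrite !inE eqxx orbT.
have [h hE] : exists x, phi x = eta by apply: lift; rewrite !inE eqxx !orbT.
have [y yE] : exists x, phi x = b by apply: lift; rewrite !inE eqxx !orbT.
have /choice[B BP] n : exists x, x \in 1%VS /\ phi x = theta_part k p n.
  by have [x x1 xE] := base_lift phiA (base_theta_part pk hK hkK hperf n); exists x.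
have /choice[C CP] n : exists x, x \in 1%VS /\
    phi x = \sum_(j < n) alpha_part k p j.+1 ^+ 2.
  have [|x x1 xE] := base_lift phiA (a := \sum_(j < n) alpha_part k p j.+1 ^+ 2).
    by apply: (subfield_sum hK) => j _; apply: (subfieldX hK); exact: base_alpha_part.
  by exists x.
by exists L, phi, a, t, h, y, B, C; split.
Qed.

(** n is a multiple of p so that the expansions of theta and eta apply; the factor p matches the
    loss in [average]. *)
Lemma small_inverse_power (e : rat) : 0 < e ->
  exists n, [/\ (0 < n)%N, (p %| n)%N & (p ^ n)%:R^-1 *+ p < e].
Proof.
move=> e0; pose m := (Num.truncn (p%:R / e)).+1; exists (p * m)%N.
rewrite muln_gt0 p_gt0 dvdn_mulr//; split => //.
have pm : 0 < (p ^ (p * m))%:R :> rat by rewrite ltr0n expn_gt0 p_gt0.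
rewrite -[_ *+ p]mulr_natl ltr_pdivrMr// mulrC -ltr_pdivrMr//.
apply: (lt_le_trans (truncnS_gt _)); rewrite ler_nat -/m.
apply: leq_trans (ltnW (ltn_expl _ p_gt1)).
by rewrite leq_pmull.
Qed.

Lemma inverse_power_le n : (p ^ n)%:R^-1 <= (p ^ n)%:R^-1 *+ p :> rat.
Proof.
by rewrite -[X in X <= _]mulr1n ler_wpMn2l// invr_ge0 ler0n.
Qed.

Lemma hval_eqy (x : hahn k) : hval x = +oo%E -> x = 0.
Proof.
move=> vx; apply/eqP; apply: contraT => /vge_lead[q xq vq].
by rewrite (hval_fin' xq vq) in vx.
Qed.

Lemma midpoint_lt (x y : rat) : x < y -> x < y - (y - x) / 2.
Proof. by move=> xy; lra. Qed.

(** * A generator of depth 2 *)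

Section UpperBound.
Variables (kap : k) (kapP : kap ^+ p != kap).

Definition zeta0 := eta + hconst kap * theta.
Local Notation zeta := zeta0.

(** The expansions of eta and kap theta without their tails: an element of K(alpha), affine in
    alpha. *)
Definition zeta_approx n := \sum_(j < n) alpha_part k p j.+1 ^+ 2
  - alpha * theta_part k p n *+ 2 - hconst kap * theta_part k p n.

Let q2 : rat := - (p ^ 2)%:R^-1.

Let pX_gt0 n : 0 < (p ^ n)%:R :> rat. Proof. by rewrite ltr0n expn_gt0 p_gt0. Qed.

Lemma zeta_sub_approx n : (p %| n)%N ->
  zeta - zeta_approx n = proot p n eta + hconst kap * proot p n theta.
Proof.
move=> pn; rewrite /zeta0 {1}(eta_expand_dvd pk pn) {1}(theta_expand_dvd pk pn).
by rewrite /zeta_approx; ring.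
Qed.

Lemma zeta_approx_vge n : (p %| n)%N -> vge (- (p ^ n)%:R^-1) (zeta - zeta_approx n).
Proof.
move=> pn; rewrite zeta_sub_approx//; apply: vgeD.
  by have := @proot_vge _ _ pk n _ _ (vge_eta pk); rewrite mulN1r.
rewrite -[X in vge X]add0r; apply: vgeM; first exact: vge_const.
apply: vge_le (@proot_vge _ _ pk n _ _ (vge_theta pk)).
rewrite mulNr lerN2 ler_pdivrMr// mulVf ?gt_eqF//.
by rewrite invf_le1// ler1n expn_gt0 p_gt0.
Qed.

Lemma theta_part_neq0 n : (0 < n)%N -> (p %| n)%N -> theta_part k p n != 0.
Proof.
move=> n0 pn; have [_ c] := theta_part_vge pk n0 pn.
by apply: contra_eq_neq c => ->; rewrite hcoef0 eq_sym oppr_eq0 oner_eq0.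
Qed.

Let two_neq0 : 2%:R != 0 :> k.
Proof.
rewrite -(dvdn_pcharf pk); apply/negP => /dvdn_leq => /(_ isT).
by rewrite leqNgt p_gt2.
Qed.

Let two_neq0_hahn : 2%:R != 0 :> hahn k.
Proof. by rewrite -(rmorph_nat (@hconst k)) fmorph_eq0. Qed.

(** The coefficient -2 [theta_part n] of alpha is a nonzero element of K, so this element generates
    K(alpha). *)
Lemma zeta_approx_degree n : (0 < n)%N -> (p %| n)%N -> has_degree K (zeta_approx n) p.
Proof.
move=> n0 pn.
have [L [phi [a [t [h [y [B [C [[phiA galL] [aE tE hE] _ BE CE]]]]]]]]] :=
  galois_setup (alg_base hK (subfield1 hK)).
have [[b1 bE] [c1 cE]] := (BE n, CE n).
pose x := C n - a * B n *+ 2 - kcst hkK L kap * B n.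
have xE : phi x = zeta_approx n.
  by rewrite /x !(rmorphB, rmorphMn, rmorphM) /= aE bE cE phi_kcst.
rewrite -xE -(alpha_degree pk hkK hlim phiA galL aE tE hE).
suff -> : adjoin_degree 1 a = adjoin_degree 1 x by exact: (has_degree_phi phiA).
have xs (s : gal_of {:L}) : s x = C n - s a * B n *+ 2 - kcst hkK L kap * B n.
  by rewrite /x !(rmorphB, rmorphMn, rmorphM) /= gal_kcst (gal_base s b1) (gal_base s c1).
apply/eqP; rewrite eqn_leq; apply/andP; split; apply: deg_le; apply: (gal_adjoin galL) => s.
  rewrite xs /x => /addIr/addrI/oppr_inj.
  rewrite -![_ * _ *+ 2]mulr_natl => /mulfI H; apply: (mulIf (x := B n)).
    by rewrite -(fmorph_eq0 phi) bE theta_part_neq0.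
  by apply: H; rewrite -(fmorph_eq0 phi) rmorph_nat.
by rewrite xs => ->.
Qed.

Let le_q2 : - (p ^ p)%:R^-1 > q2.
Proof. by rewrite /q2 ltrN2 ltf_pV2 ?posrE// ltr_nat ltn_exp2l. Qed.

Lemma zeta_alpha : exists2 c, K c &
  vge q2 (zeta - (c - alpha * theta_part k p p *+ 2)).
Proof.
exists (\sum_(j < p) alpha_part k p j.+1 ^+ 2 - hconst kap * theta_part k p p).
  apply: (subfieldB hK).
    by apply: (subfield_sum hK) => j _; apply: (subfieldX hK); exact: base_alpha_part.
  by apply: (subfieldM hK); [exact: base_const|exact: base_theta_part].
have := zeta_approx_vge (dvdnn p) => /(vge_le (ltW le_q2)).
by congr vge; rewrite /zeta_approx; ring.
Qed.

(** By [zeta_alpha], such a c would approximate 2 T alpha, with T = [theta_part] p of valuation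
    -1/p^2. Dividing by 2 T contradicts [alpha_far]. *)
Lemma zeta_far c : K c -> vge q2 (zeta - c) -> False.
Proof.
move=> Kc vc; have [c' Kc' vc'] := zeta_alpha.
have [vT cT] := theta_part_vge pk p_gt0 (dvdnn p); set T := theta_part k p p in vT cT vc'.
have T0 : T != 0 by exact: theta_part_neq0.
have T2 : T * 2%:R != 0 by rewrite mulf_neq0.
apply: (@alpha_far R k p pk K hlim ((c' - c) / (T * 2%:R))).
  apply: (subfieldM hK); first exact: (subfieldB hK).
  apply: (subfieldV hK); apply: (subfieldM hK); first exact: base_theta_part.
  rewrite -(rmorph_nat (@hconst k)); exact: base_const.
have v : vge q2 (alpha * (T * 2%:R) - (c' - c)).
  have := vgeB vc' vc; congr vge; ring.
have cT2 : (T * 2%:R) q2 != 0.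
  by rewrite mulr_natr hcoefMn cT mulNrn oppr_eq0.
have vT2 : vge q2 (T * 2%:R) by rewrite mulr_natr; exact: vgeMn.
have [vV _] := vgeV cT2 vT2.
have := vgeM v vV; rewrite subrr; congr vge.
by rewrite mulrBl mulfK.
Qed.

(** Replacing alpha by [alpha_part n] in [zeta_alpha] costs only 1/p^n in valuation. *)
Lemma zeta_near n : exists2 c, K c & vge (q2 - (p ^ n)%:R^-1) (zeta - c).
Proof.
have [c Kc vc] := zeta_alpha; have [vT _] := theta_part_vge pk p_gt0 (dvdnn p).
exists (c - alpha_part k p n * theta_part k p p *+ 2).
  apply: (subfieldB hK) => //; rewrite -[_ *+ 2]mulr_natr.
  apply: (subfieldM hK).
    by apply: (subfieldM hK); [exact: base_alpha_part|exact: base_theta_part].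
  rewrite -(rmorph_nat (@hconst k)); exact: base_const.
have -> : zeta - (c - alpha_part k p n * theta_part k p p *+ 2) =
    (zeta - (c - alpha * theta_part k p p *+ 2))
    - (alpha - alpha_part k p n) * theta_part k p p *+ 2 by ring.
apply: vgeB.
  by apply: vge_le vc; rewrite gerBl invr_ge0 ler0n.
apply: vgeMn; rewrite addrC; apply: vgeM => //; rewrite -(proot_alpha pk).
apply: vge_le (@proot_vge _ _ pk n _ _ (vge_alpha pk)).
rewrite mulNr lerN2 ler_pdivrMr// mulVf ?gt_eqF//.
by rewrite invf_le1 ?ler1n// ltr0n.
Qed.

Let Kq2 c : K (hmono c q2).
Proof.
have -> : hmono c q2 = hconst c * ymono k p 2 by rewrite hmonoM mulr1 add0r.
by apply: (subfieldM hK); [exact: base_const|exact: base_ymono].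
Qed.

Lemma close_degree2 b m : has_degree K b m -> vge q2 (zeta - b) -> (p <= m)%N.
Proof.
move=> bm vb.
have [L [phi [a [t [h [y [B [C [[phiA galL] [aE tE hE] yE BE CE]]]]]]]]] :=
  galois_setup (alg_has_degree hK bm).
rewrite -yE in bm vb.
rewrite (has_degree_uniq bm (has_degree_phi phiA y)).
rewrite -(alpha_degree pk hkK hlim phiA galL aE tE hE); apply: deg_le.
apply: (@close_adjoin _ _ _ hkK hhens _ _ phiA galL t h kap _ _ q2) => //.
  by rewrite (phi_zeta hkK phiA tE hE).
by move=> s; exact: (zeta_close_alpha pk p_gt2 phiA aE tE hE).
Qed.

Lemma close_degree0 b m n : has_degree K b m -> vge 0 (zeta - b) ->
  has_degree K zeta n -> (n <= m)%N.
Proof.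
move=> bm vb zn.
have [L [phi [a [t [h [y [B [C [[phiA galL] [aE tE hE] yE BE CE]]]]]]]]] :=
  galois_setup (alg_has_degree hK bm).
have zE := phi_zeta hkK phiA tE hE kap.
rewrite -yE in bm vb; rewrite /zeta0 -zE in zn vb.
rewrite (has_degree_uniq bm (has_degree_phi phiA y)).
rewrite (has_degree_uniq zn (has_degree_phi phiA _)); apply: deg_le.
apply: (@close_adjoin _ _ _ hkK hhens _ _ phiA galL t h kap _ _ 0) => //.
  by move=> c; exact: base_const.
move=> s /(zeta_close pk p_gt2 phiA aE tE hE kapP)[_ st sh].
by rewrite gal_zeta st sh.
Qed.

(** K(zeta) contains alpha, and the commutator fixes alpha but moves zeta. *)
Lemma zeta_degree : exists2 n, has_degree K zeta n & (p < n)%N.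
Proof.
have [L [phi [a [t [h [y [B [C [[phiA galL] [aE tE hE] _ BE CE]]]]]]]]] :=
  galois_setup (alg_base hK (subfield1 hK)).
have zE := phi_zeta hkK phiA tE hE kap.
exists (adjoin_degree 1 (h + kcst hkK L kap * t)).
  by rewrite /zeta0 -zE; exact: (has_degree_phi phiA).
rewrite -(alpha_degree pk hkK hlim phiA galL aE tE hE).
have [s1 [s2 [e [e0 _ ta tt th]]]] := commutator_ex pk p_gt2 hkK hlim phiA galL aE tE hE.
apply: deg_lt ta _.
  apply: (gal_adjoin galL) => s sz.
  have [|-> //] := @zeta_close _ _ pk p_gt2 _ _ hkK _ _ phiA a t h aE tE hE _ kapP s.
  by rewrite sz subrr.
rewrite gal_zeta tt th addrAC -[X in _ != X]addr0 (inj_eq (addrI _)).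
by rewrite -(fmorph_eq0 phi) phi_kcst// fmorph_eq0.
Qed.

Lemma adjoin_zeta : N = adjoin K [set zeta].
Proof.
have [L [phi [a [t [h [y [B [C [[phiA galL] [aE tE hE] _ BE CE]]]]]]]]] :=
  galois_setup (alg_base hK (subfield1 hK)).
have zE := phi_zeta hkK phiA tE hE kap.
have close s := @zeta_close _ _ pk p_gt2 _ _ hkK _ _ phiA a t h aE tE hE _ kapP s.
apply/seteqP; split=> x xN.
  apply: xN; split; first exact: adjoin_subfield.
  move=> b [Kb|[->|->]]; first exact: sub_adjoin.
    rewrite -tE /zeta0 -zE; apply: (phi_adjoin phiA); apply: (gal_adjoin galL) => s sz.
    by have [|_ ->] := close s; first by rewrite sz subrr.
  rewrite -hE /zeta0 -zE; apply: (phi_adjoin phiA); apply: (gal_adjoin galL) => s sz.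
  by have [|_ _ ->] := close s; first by rewrite sz subrr.
have hN := adjoin_subfield hK [set theta; eta].
apply: xN; split => // b [Kb|->]; first exact: sub_adjoin.
apply: (subfieldD hN); first by apply: mem_adjoin; right.
apply: (subfieldM hN); first by apply: sub_adjoin; exact: base_const.
by apply: mem_adjoin; left.
Qed.

Lemma zeta_depth : is_depth K zeta 2.
Proof.
have [n zn pn] := zeta_degree.
(* The degree sequence is 1, p, n. *)
exists (fun l => if l is l'.+1 then (if l' is _.+1 then n else p) else 1%N).
split => // -[|[|//]] _; split.
- split => //; exists (hval (zeta - zeta_approx p)).
    exists (zeta_approx p) => //=.
    by apply: zeta_approx_degree.
  move=> _ [c /= c1 <-]; rewrite ltNge; apply/negP => le.
  apply: (zeta_far (has_degree1 hK c1)); apply/hval_ge; apply: le_trans le.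
  by apply/hval_ge; apply: vge_le (ltW le_q2) _; exact: zeta_approx_vge.
(* If b beats every element of K, then v(zeta - b) >= -1/p^2, since K reaches valuations arbitrarily
   close to this from below. *)
- move=> m [m1 [_ [b /= bm <-] b_gt]]; apply: (close_degree2 bm) => r rq.
  have [j [j0 pj je]] := @small_inverse_power (q2 - r) ltac:(by rewrite subr_gt0).
  have [c Kc vc] := zeta_near j.
  have /ltW le : (hval (zeta - c)%R < hval (zeta - b)%R)%E.
    by apply: b_gt; exists c => //=; exact: has_degree1_mem.
  have : vge (q2 - (p ^ j)%:R^-1) (zeta - b).
    by apply/hval_ge; apply: le_trans le; apply/hval_ge.
  apply; rewrite ltrBrDr -ltrBrDl; exact: le_lt_trans (inverse_power_le j) je.
- split => //; exists +oo%E; first by exists zeta => //; rewrite subrr hval0.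
  move=> _ [b /= bp <-]; rewrite ltey; apply/negP => /eqP/hval_eqy/eqP.
  rewrite subr_eq0 => /eqP zb; rewrite -zb in bp.
  by move: pn; rewrite (has_degree_uniq bp zn) ltnn.
(* Likewise the [zeta_approx j], all of degree p, force v(zeta - b) >= 0. *)
- move=> m [m1 [_ [b /= bm <-] b_gt]]; apply: (close_degree0 bm _ zn) => r r0.
  have [j [j0 pj je]] := @small_inverse_power (- r) ltac:(by rewrite oppr_gt0).
  have /ltW le : (hval (zeta - zeta_approx j)%R < hval (zeta - b)%R)%E.
    by apply: b_gt; exists (zeta_approx j) => //=; exact: zeta_approx_degree.
  have : vge (- (p ^ j)%:R^-1) (zeta - b).
    by apply/hval_ge; apply: le_trans le; apply/hval_ge; exact: zeta_approx_vge.
  by apply; rewrite ltrNr; exact: le_lt_trans (inverse_power_le j) je.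
Qed.

End UpperBound.
(** A root of X^p - X - 1 satisfies c^p = c + 1. *)
Lemma artin_schreier_root : exists c : k, c ^+ p != c.
Proof.
have sf : size ('X^p - 'X - 1 : {poly k}) = p.+1.
  rewrite -addrA size_polyDl ?size_polyXn// -opprD size_polyN ltnS.
  apply: leq_trans (size_polyD _ _) _.
  by rewrite size_polyX size_poly1.
have /closed_rootP[c] : size ('X^p - 'X - 1 : {poly k}) != 1%N.
  by rewrite sf eqSS gtn_eqF.
rewrite /root !hornerE subr_eq0 => /eqP E; exists c.
by rewrite -subr_eq0 E oner_neq0.
Qed.

(** * No generator has depth less than 2 *)

Lemma depth_ge2 zeta r :
  N = adjoin K [set zeta] -> is_depth K zeta r -> (2 <= r)%N.
Proof.
move=> NE [d [d0 dr dnext]].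
have [L [phi [a [t [h [z [B [C [[phiA galL] [aE tE hE] zE BE CE]]]]]]]]] :=
  galois_setup (alg_has_degree hK dr).
have Nz : inN a t h z.
  move=> s sa st sh; apply: (@adjoin_fix _ _ _ _ _ phiA [set theta; eta]).
    by move=> _ [->|->]; [exists t|exists h].
  by rewrite NE zE; exact: mem_adjoin.
have gen (s : gal_of {:L}) : s z = z -> [/\ s a = a, s t = t & s h = h].
  move=> sz; have fix_N x : N (phi x) -> s x = x.
    rewrite NE; apply: (adjoin_fix phiA) => _ ->; by exists z.
  have st : s t = t by apply: fix_N; rewrite tE; apply: mem_adjoin; left.
  have sh : s h = h by apply: fix_N; rewrite hE; apply: mem_adjoin; right.
  split => //; have -> : a = t ^+ p - t.
    by apply: (fmorph_inj phi); rewrite aE rmorphB rmorphXn tE /= (theta_eq pk).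
  by rewrite rmorphB rmorphXn /= st.
have [s1 [s2 [e [e0 _ ta tt th]]]] := commutator_ex pk p_gt2 hkK hlim phiA galL aE tE hE.
set u := (s1 * s2)%g in ta tt th; set w := (s2 * s1)%g in ta tt th.
set tau := (u * w^-1)%g in ta tt th.
have tz : tau z != z.
  apply/eqP => /gen[_ _]; rewrite th -[X in _ = X]addr0 => /addrI/eqP.
  by rewrite -(fmorph_eq0 phi) phi_kcst// fmorph_eq0 (negPf e0).
rewrite leqNgt; apply/negP => r_lt2.
(* Depth 0 would put zeta in K, where tau acts trivially. *)
have r1 : r = 1%N.
  case: r dr dnext r_lt2 => [|[|//]]// dr _ _; exfalso; move/eqP: tz; apply.
  rewrite d0 in dr; have [x x1 xE] := base_lift phiA (has_degree1 hK dr).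
  have -> : z = x by apply: (fmorph_inj phi); rewrite zE xE.
  exact: gal_base.
have [_ d_min] := dnext 0%N ltac:(by rewrite r1).
rewrite r1 in dr; rewrite d0 in d_min.
have dE : d 1%N = adjoin_degree 1 z.
  by rewrite -zE in dr; exact: has_degree_uniq dr (has_degree_phi phiA z).
have [q uq vq] : exists2 q, (phi (tau z) - phi z) q != 0 & vge q (phi (tau z) - phi z).
  by apply: vge_lead; rewrite -rmorphB fmorph_eq0 subr_eq0.
(* The average f lies in N and is fixed by tau, so its degree is less than that of zeta. As the
   sequence jumps from 1 to deg zeta, some element of K approximates zeta at least as well as f. *)
have approx eps : 0 < eps -> exists2 c, K c & vge (q - eps) (phi z - c).
  move=> /small_inverse_power[n [n0 pn neps]].
  have [f [tf Nf vf]] :=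
    average pk (hkK := hkK) hhens phiA galL aE tE hE BE CE pn ta tt th e0 Nz vq.
  have {}vf : vge (q - eps) (phi z - phi f).
    by apply: vge_le vf; rewrite lerD2l lerN2 ltW.
  have fz : f \in <<1; z>>%VS.
    by apply: (gal_adjoin galL) => s /gen[sa st sh]; exact: Nf.
  have deg_f := deg_lt fz tf tz; rewrite -dE in deg_f.
  have hf := has_degree_phi phiA f.
  have [f1|f1] := leqP (adjoin_degree 1 f) 1.
    exists (phi f) => //; apply: (has_degree1 hK).
    suff <- : adjoin_degree 1 f = 1%N by [].
    by apply/eqP; rewrite eqn_leq f1.
  apply: contrapT => H; suff /d_min : next_degree K zeta 1 (adjoin_degree 1 f).
    by rewrite leqNgt deg_f.
  split => //; exists (hval (zeta - phi f)); first by exists (phi f).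
  move=> _ [c /= c1 <-]; rewrite ltNge; apply/negP => le; apply: H.
  exists c; first exact: has_degree1.
  by rewrite zE; apply/hval_ge; apply: le_trans le; apply/hval_ge; rewrite -zE.
have close (s : gal_of {:L}) : vge q (phi (s z) - phi z).
  move=> m mq; have [c Kc vc] := approx ((q - m) / 2) ltac:(by rewrite divr_gt0 ?subr_gt0).
  have [y y1 yE] := base_lift phiA Kc.
  have Ky : phi y \in K by apply: mem_set; rewrite yE.
  have := @gal_vge_sub _ _ _ hhens _ _ phiA galL s (q - (q - m) / 2) z y Ky.
  by rewrite yE => /(_ vc); apply; exact: midpoint_lt.
(* s' preserves the coefficient of s z - z at q by [gal_coef], so this coefficient is additive in
   s. *)
have add (s s' : gal_of {:L}) : (phi ((s * s')%g z) - phi z) q =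
    (phi (s z) - phi z) q + (phi (s' z) - phi z) q.
  have -> : phi ((s * s')%g z) - phi z = phi (s' (s z - z)) + (phi (s' z) - phi z).
    by rewrite galMx rmorphB /= rmorphB; ring.
  rewrite hcoefD (gal_coef pk hkK hhens phiA galL aE tE hE); first by rewrite rmorphB.
    move=> g ga gt gh; rewrite rmorphB /= (Nz g)//; congr (_ - _).
    exact: (inN_gal pk hkK phiA aE tE hE s Nz).
  by rewrite rmorphB; exact: close.
move/eqP: uq; apply.
(* The coefficient at q is thus the difference of the values of the additive character at s1 s2 and
   s2 s1, which is 0, contradicting the choice of q. *)
have -> : phi (tau z) - phi z = phi (w^-1%g (u z - w z)).
  by rewrite rmorphB /= -!galMx mulgV gal_id rmorphB.
have uwE : phi (u z) - phi (w z) = (phi (u z) - phi z) - (phi (w z) - phi z) by ring.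
rewrite (gal_coef pk hkK hhens phiA galL aE tE hE).
- rewrite rmorphB uwE hcoefB (add s1 s2) (add s2 s1) [X in X - _]addrC.
  exact: subrr.
- move=> g ga gt gh; rewrite rmorphB /=.
  by rewrite (inN_gal pk hkK phiA aE tE hE u Nz)// (inN_gal pk hkK phiA aE tE hE w Nz).
- by rewrite rmorphB uwE; apply: vgeB; exact: close.
Qed.

End Depth.

Theorem mainTheorem8 (R : realType) (k : closedFieldType) (p : nat)
    (hp : p \in [pchar k]) (hp2 : (2 < p)%N)
    (K : set (hahn k)) (hK : is_subfield K) (hkK : ratfuns k `<=` K)
    (hhens : henselian K) (hperf : perfect_subfield K)
    (hlim : no_finite_limits R K) :
  is_ext_depth K (adjoin K [set theta k p; eta k p]) 2.
Proof.
have [kap kapP] := artin_schreier_root hp; split.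
  exists (zeta0 p kap); first exact: adjoin_zeta.
  exact: (zeta_depth hp hp2 hK hkK hhens hperf hlim kapP).
by move=> zeta s; exact: (depth_ge2 hp hp2 hK hkK hhens hperf hlim).
Qed.
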